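(* Let $E$ be a row-finite directed graph with no sinks. Then $C^*(E)$ is liminal if and only if $E$ satisfies condition $(M)$.
   Context: A directed graph $E=(E^0,E^1,o,t)$ consists of countable sets $E^0$ (vertices) and $E^1$ (edges) and maps $o,t:E^1\to E^0$ (origin and terminus). It is row-finite if every vertex emits at most finitely many edges; a sink is a vertex emitting no edge. An infinite path is a sequence of edges $e_1e_2\cdots$ with $t(e_i)=o(e_{i+1})$, with origin $o(e_1)$; $E^\infty$ is the set of infinite paths. For a row-finite graph with no sinks, $C^*(E)$ is the universal $C^*$-algebra generated by a Cuntz-Krieger $E$-family: mutually orthogonal projections $\{p_v:v\in E^0\}$ and partial isometries $\{s_e:e\in E^1\}$ with $s_e^*s_e=p_{t(e)}$ for all $e\in E^1$ and $\sum_{o(e)=v}s_es_e^*=p_v$ for all $v\in E^0$. For $p=e_1e_2\cdots$ and $q=f_1f_2\cdots$ in $E^\infty$, $p\sim q$ iff there are $j,k$ with $e_{j+r}=f_{k+r}$ for all $r\ge0$. Condition $(M)$: for every $v\in E^0$ and every $[p]\in E^\infty/\sim$ there are only finitely many representatives of $[p]$ that begin with $v$ (have origin $v$). Liminal (CCR) means that the image of every irreducible representation consists of compact operators. *)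

(* Defs.v *)
From HB Require Import structures.
From mathcomp Require Import all_boot all_order all_algebra sesquilinear.
From mathcomp Require Import complex.
From mathcomp Require Import boolp classical_sets functions cardinality fsbigop.
From mathcomp Require Import reals topology normedtype.

Set Implicit Arguments.
Unset Strict Implicit.
Unset Printing Implicit Defensive.

Import Order.TTheory GRing.Theory Num.Theory.
Import numFieldNormedType.Exports.

Local Open Scope classical_set_scope.
Local Open Scope ring_scope.
Local Open Scope complex_scope.

Record digraph := Digraph {
  vertex : countType;
  edge : countType;
  origin : edge -> vertex;
  terminus : edge -> vertex }.

Arguments origin {d} e.
Arguments terminus {d} e.

Section Graphs.
Variable E : digraph.

Definition emitted (v : vertex E) : set (edge E) := [set e | origin e = v].

Definition row_finite := forall v : vertex E, finite_set (emitted v).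

Definition no_sinks := forall v : vertex E, emitted v !=set0.

(* The edges e_1 e_2 ... of a path are numbered from 0 here. *)
Definition infinite_paths : set (nat -> edge E) :=
  [set p | forall n, terminus (p n) = origin (p n.+1)].

Definition path_origin (p : nat -> edge E) : vertex E := origin (p 0%N).

Definition tail_equiv (p q : nat -> edge E) :=
  exists j k, forall r, p (j + r)%N = q (k + r)%N.

Definition path_class (p : nat -> edge E) : set (nat -> edge E) :=
  [set q | infinite_paths q /\ tail_equiv p q].

Definition condition_M := forall (v : vertex E) (p : nat -> edge E),
  infinite_paths p ->
  finite_set (path_class p `&` [set q | path_origin q = v]).

End Graphs.

(* C*-algebras are not assumed unital: C*(E) has no unit when E has infinitely
   many vertices, and it is zero when E is empty. This is why the product is
   not that of a MathComp ring. *)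
HB.mixin Record isCStarAlgebra (R : realType) A
    of CompleteNormedModule R[i] A := {
  cmul : A -> A -> A;
  star : A -> A;
  cmulA : forall x y z, cmul x (cmul y z) = cmul (cmul x y) z;
  cmul_linearl : forall (c : R[i]) (x y z : A),
    cmul (c *: x + y) z = c *: cmul x z + cmul y z;
  cmul_linearr : forall (c : R[i]) (x y z : A),
    cmul z (c *: x + y) = c *: cmul z x + cmul z y;
  star_antilinear : forall (c : R[i]) (x y : A),
    star (c *: x + y) = Num.conj c *: star x + star y;
  starK : forall x, star (star x) = x;
  starM : forall x y, star (cmul x y) = cmul (star y) (star x);
  norm_cmul_le : forall x y : A, `|cmul x y| <= `|x| * `|y|;
  norm_star_cmul : forall x : A, `|cmul (star x) x| = `|x| ^+ 2 }.

#[short(type="cstarAlgType")]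
HB.structure Definition CStarAlgebra (R : realType) :=
  { A of CompleteNormedModule R[i] A & isCStarAlgebra R A }.

HB.mixin Record isHilbert (R : realType) H of CompleteNormedModule R[i] H := {
  dotp : {dot H for (@Num.conj R[i])};
  normr_dotp : forall x : H, `|x| ^+ 2 = dotp x x }.

#[short(type="hilbertType")]
HB.structure Definition Hilbert (R : realType) :=
  { H of CompleteNormedModule R[i] H & isHilbert R H }.

Notation "x ** y" := (cmul x y) (at level 40, left associativity) : ring_scope.

Section CStarAlgebras.
Context {R : realType}.

Definition star_hom (A B : cstarAlgType R) (f : {linear A -> B}) :=
  (forall x y, f (x ** y) = f x ** f y) /\ (forall x, f (star x) = star (f x)).

Definition closed_subspace (V : completeNormedModType R[i]) (S : set V) :=
  [/\ closed S, S 0 & forall (c : R[i]) x y, S x -> S y -> S (c *: x + y)].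

Definition cstar_subalgebra (A : cstarAlgType R) (S : set A) :=
  [/\ closed_subspace S, forall x y, S x -> S y -> S (x ** y)
    & forall x, S x -> S (star x)].

Definition projection (A : cstarAlgType R) (x : A) :=
  x ** x = x /\ star x = x.

Definition partial_isometry (A : cstarAlgType R) (x : A) :=
  x ** star x ** x = x.

(* The *-homomorphisms from A to the bounded operators on H; the last clause
   says that pi (star a) is the Hilbert-space adjoint of pi a. *)
Record is_representation (A : cstarAlgType R) (H : hilbertType R)
    (pi : A -> {linear H -> H}) : Prop := {
  rep_continuous : forall a, continuous (pi a);
  rep_linear : forall (c : R[i]) (a b : A) (x : H),
    pi (c *: a + b) x = c *: pi a x + pi b x;
  rep_mul : forall a b x, pi (a ** b) x = pi a (pi b x);
  rep_star : forall a x y, dotp (pi a x) y = dotp x (pi (star a) y) }.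

Definition irreducible (A : cstarAlgType R) (H : hilbertType R)
    (pi : A -> {linear H -> H}) :=
  (exists a x, pi a x <> 0) /\
  forall S : set H, closed_subspace S -> (forall a x, S x -> S (pi a x)) ->
    S = [set 0] \/ S = setT.

Definition compact_operator (H : hilbertType R) (T : {linear H -> H}) :=
  precompact (T @` [set x | `|x| <= 1]).

Definition liminal (A : cstarAlgType R) :=
  forall (H : hilbertType R) (pi : A -> {linear H -> H}),
    is_representation pi -> irreducible pi ->
    forall a, compact_operator (pi a).

End CStarAlgebras.

Section GraphAlgebras.
Context {R : realType}.
Variable E : digraph.

(* The sum in ck_range is a genuine sum only when emitted v is finite: \sum_(_ \in _)
   is 0 on infinite supports. So this is the notion for row-finite graphs (and,
   at a sink, it would force p v = 0). *)
Record cuntz_krieger (B : cstarAlgType R)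
    (p : vertex E -> B) (s : edge E -> B) : Prop := {
  ck_projection : forall v, projection (p v);
  ck_orthogonal : forall v w, v <> w -> p v ** p w = 0;
  ck_partial_isometry : forall e, partial_isometry (s e);
  ck_source : forall e, star (s e) ** s e = p (terminus e);
  ck_range : forall v, \sum_(e \in emitted v) (s e ** star (s e)) = p v }.

(* (A, p, s) is C*(E): A is generated as a C*-algebra by the Cuntz-Krieger
   family (p, s), and this family is universal. Uniqueness of the induced
   homomorphism f follows from generation. *)
Record is_graph_algebra (A : cstarAlgType R)
    (p : vertex E -> A) (s : edge E -> A) : Prop := {
  ga_cuntz_krieger : cuntz_krieger p s;
  ga_generated : forall S : set A, cstar_subalgebra S ->
    (forall v, S (p v)) -> (forall e, S (s e)) -> S = setT;
  ga_universal : forall (B : cstarAlgType R)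
      (q : vertex E -> B) (t : edge E -> B), cuntz_krieger q t ->
    exists2 f : {linear A -> B}, star_hom f &
      (forall v, f (p v) = q v) /\ (forall e, f (s e) = t e) }.

End GraphAlgebras.

(* Main.v *)
(* Liminal implies (M): C*(E) acts on l^2 of a tail-equivalence class of paths,
   s_e sending d_q to d_(e q). A closed invariant subspace containing f with
   f(q) <> 0 contains d_q, because restricting f to the paths that begin with
   the first k edges of q is an element of the algebra; hence it contains every
   d_r, and the action is irreducible. There p_v projects onto the span of the
   d_q with q starting at v, so compactness of p_v bounds their number.

   (M) implies liminal: in an irreducible representation call v live if p_v <> 0.
   Any two live vertices have walks to a common live vertex, so under (M) some
   live w has, for each length, only one walk to a live vertex; these walks are
   the initial segments q|k of one path q. The operators s_(q|k) s_(q|l)^* on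
   p_w H commute, so Schur's lemma makes any xi in p_w H a common eigenvector.
   Transporting xi along the paths at v that are tail equivalent to q gives an
   orthogonal family spanning p_v H, finite by (M). So the p_v are compact, and
   with them the whole image.

   In place of the functional calculus, both the contractivity of
   representations and Schur's lemma use 1 - (1 - b)^(1/2), the limit of the
   iteration d |-> (b + d^2) / 2. *)
Require Import Defs.
From mathcomp Require Import all_boot all_order all_algebra reals.
From HB Require Import structures.
From mathcomp Require Import sesquilinear finmap complex ring lra.
From mathcomp Require Import boolp classical_sets functions cardinality fsbigop.
From mathcomp Require Import topology normedtype sequences.

Set Implicit Arguments.
Unset Strict Implicit.
Unset Printing Implicit Defensive.

Import Order.TTheory GRing.Theory Num.Theory.
Import numFieldNormedType.Exports.

Local Open Scope classical_set_scope.
Local Open Scope ring_scope.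
Local Open Scope complex_scope.

(** * Square roots in C*-algebras and Schur's lemma *)

Section Complex.
Variable R : realType.

(** Schur's lemma is required because the path [q] may end in a cycle. If no vertex of [q] repeats,
    then [vtx k = vtx l] only for [k = l], and s_(q|k) s_(q|l)^* is the identity of p_w H. If [q]
    ends in a cycle, these operators are the powers of one unitary, as for a single loop, where the
    algebra is C(T). Only irreducibility makes that unitary a scalar.

    In this direction irreducibility enters in one form: for nonzero x and y some coefficient <s_m
    s_n^* x, y> is nonzero. Schur's lemma is proved from such a nondegeneracy, without spectral
    projections: if c is selfadjoint with <c x, x> = 0, then (|c| - c)(|c| + c) = 0 makes one factor
    kill x, whence |c| x = 0 and c x = 0. As a limit of polynomials, |c| inherits every closed
    algebraic relation that c satisfies.

    A representation is only assumed to send each element to a continuous operator. The bound |pi a|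
    <= |a| is what makes sets of elements defined by their action closed, and generation of C*(E)
    speaks of closed subalgebras only. *)

Lemma complex_gt0P (e : R[i]) : 0 < e -> exists2 r : R, 0 < r & e = r%:C.
Proof.
by case: e => a b; rewrite ltcE /= => /andP[/eqP -> a0]; exists a.
Qed.

Lemma complex_ge0P (e : R[i]) : 0 <= e -> exists2 r : R, 0 <= r & e = r%:C.
Proof.
by case: e => a b; rewrite lecE /= => /andP[/eqP -> a0]; exists a.
Qed.

Lemma ler0_small (x c : R[i]) : 0 <= x -> 0 <= c ->
  (forall d : R[i], 0 < d -> x <= c * d) -> x = 0.
Proof.
move=> x0 c0 h; apply: contrapT => /eqP xn0.
have xgt0 : 0 < x by rewrite lt_def xn0.
have c1 : 0 < 2 * (c + 1) by rewrite mulr_gt0 ?ltr0n// ltr_wpDl.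
have := h (x / (2 * (c + 1))) (divr_gt0 xgt0 c1).
rewrite mulrCA -{1}(mulr1 x) ler_pM2l// ler_pdivlMr// mul1r => h1.
have : c < 2 * (c + 1).
  have -> : 2 * (c + 1) = c + (c + 2) by ring.
  by rewrite ltrDl ltr_wpDl.
by move/lt_geF; rewrite h1.
Qed.

End Complex.

Lemma closed_lipschitz_eq0 (K : numFieldType) (V W : normedModType K)
    (f : V -> W) (C : K) :
  0 <= C -> (forall x y, `|f x - f y| <= C * `|x - y|) ->
  closed [set x | f x = 0].
Proof.
move=> C0 fC x hx; apply: contrapT => /eqP; rewrite -normr_gt0 => fx0.
(* [C + 1] instead of [C], so that the radius below is positive even when [C = 0]. *)
have C1 : 0 < C + 1 by rewrite ltr_wpDl.
have [|y [/= fy]] := hx (ball x (`|f x| / (C + 1))).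
  by apply: nbhsx_ballx; rewrite divr_gt0.
rewrite -ball_normE /= ltr_pdivlMr// => h.
have := fC x y; rewrite fy subr0 => h2.
have : `|f x| < `|f x|.
  rewrite {1}(le_lt_trans h2)// (le_lt_trans _ h)//.
  by rewrite mulrC ler_wpM2l// lerDl.
by rewrite ltxx.
Qed.

Section Hilbert.
Variables (R : realType) (H : hilbertType R).
Implicit Types (x y z : H) (c : R[i]).

Lemma dotpDl x y z : dotp (x + y) z = dotp x z + dotp y z.
Proof. exact: linearDl. Qed.

Lemma dotpDr x y z : dotp z (x + y) = dotp z x + dotp z y.
Proof. exact: raddfD. Qed.

Lemma dotpZl c x z : dotp (c *: x) z = c * dotp x z.
Proof. exact: linearZl_LR. Qed.

Lemma dotpZr c x z : dotp z (c *: x) = Num.conj c * dotp z x.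
Proof. exact: linearZ. Qed.

Lemma dotpC x y : dotp x y = Num.conj (dotp y x).
Proof. by rewrite hermC expr0 mul1r. Qed.

Lemma dotp0l z : dotp 0 z = 0 :> R[i].
Proof. by rewrite -(scale0r 0) dotpZl mul0r. Qed.

Lemma dotp0r z : dotp z 0 = 0 :> R[i].
Proof. by rewrite -(scale0r 0) dotpZr rmorph0 mul0r. Qed.

Lemma dotpNl x z : dotp (- x) z = - dotp x z.
Proof. by rewrite -scaleN1r dotpZl mulN1r. Qed.

Lemma dotpNr x z : dotp z (- x) = - dotp z x.
Proof. by rewrite -scaleN1r dotpZr rmorphN1 mulN1r. Qed.

Lemma dotpBl x y z : dotp (x - y) z = dotp x z - dotp y z.
Proof. by rewrite dotpDl dotpNl. Qed.

Lemma dotpBr x y z : dotp z (x - y) = dotp z x - dotp z y.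
Proof. by rewrite dotpDr dotpNr. Qed.

Lemma dotp_suml (I : Type) (r : seq I) (P : pred I) (F : I -> H) z :
  dotp (\sum_(i <- r | P i) F i) z = \sum_(i <- r | P i) dotp (F i) z.
Proof.
by elim/big_rec2: _ => [|i a b _ <-]; rewrite ?dotp0l// dotpDl.
Qed.

Lemma dotp_sumr (I : Type) (r : seq I) (P : pred I) (F : I -> H) z :
  dotp z (\sum_(i <- r | P i) F i) = \sum_(i <- r | P i) dotp z (F i).
Proof.
by elim/big_rec2: _ => [|i a b _ <-]; rewrite ?dotp0r// dotpDr.
Qed.

Lemma dotp_eq0 x : dotp x x = 0 -> x = 0.
Proof.
by move=> /eqP; rewrite -normr_dotp expf_eq0 /= normr_eq0 => /eqP.
Qed.

Lemma dotp_ext x y : (forall z, dotp x z = dotp y z) -> x = y.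
Proof.
move=> h; apply/eqP; rewrite -subr_eq0; apply/eqP/dotp_eq0.
by rewrite dotpBl h subrr.
Qed.

Lemma dotp_ge0 x : 0 <= dotp x x :> R[i].
Proof. by rewrite -normr_dotp exprn_ge0. Qed.

Lemma pythagoras x y : dotp x y = 0 -> `|x + y| ^+ 2 = `|x| ^+ 2 + `|y| ^+ 2.
Proof.
move=> h; rewrite !normr_dotp dotpDl !dotpDr (dotpC y x) h.
by rewrite rmorph0 addr0 add0r.
Qed.

Lemma dotp_norm_le x y : `|dotp x y| <= `|x| * `|y|.
Proof.
have [->|y0] := eqVneq y 0; first by rewrite dotp0r normr0 mulr_ge0.
have yy0 : dotp y y != 0 :> R[i] by apply: contra y0 => /eqP/dotp_eq0 ->.
pose a := dotp x y / dotp y y.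
have ayx : a * dotp y y = dotp x y by rewrite /a divfK.
have o : dotp (x - a *: y) (a *: y) = 0.
  by rewrite dotpZr dotpBl dotpZl ayx subrr mulr0.
have := pythagoras o; rewrite subrK => e.
have h : `|a *: y| <= `|x|.
  by rewrite -(@ler_pXn2r _ 2) ?nnegrE// e lerDr exprn_ge0.
rewrite -ayx normrM -normr_dotp normrX normr_id expr2 mulrA.
by rewrite ler_wpM2r// -normrZ.
Qed.

Lemma dotp_closed y : closed [set x : H | dotp x y = 0].
Proof.
apply: (@closed_lipschitz_eq0 _ H R[i]^o (fun x => dotp x y) `|y|) => // x z.
by rewrite -dotpBl mulrC dotp_norm_le.
Qed.

End Hilbert.

Section CStarTheory.
Variables (R : realType) (A : cstarAlgType R).
Implicit Types (x y z : A) (c : R[i]).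

Lemma cmulDl x y z : (x + y) ** z = x ** z + y ** z.
Proof. by have := cmul_linearl 1 x y z; rewrite !scale1r. Qed.

Lemma cmulDr x y z : z ** (x + y) = z ** x + z ** y.
Proof. by have := cmul_linearr 1 x y z; rewrite !scale1r. Qed.

Lemma cmul0l z : 0 ** z = 0 :> A.
Proof. by apply: (addrI (0 ** z)); rewrite -cmulDl !addr0. Qed.

Lemma cmul0r z : z ** 0 = 0 :> A.
Proof. by apply: (addrI (z ** 0)); rewrite -cmulDr !addr0. Qed.

Lemma cmulZl c x z : (c *: x) ** z = c *: (x ** z).
Proof. by have := cmul_linearl c x 0 z; rewrite !addr0 cmul0l addr0. Qed.

Lemma cmulZr c x z : z ** (c *: x) = c *: (z ** x).
Proof. by have := cmul_linearr c x 0 z; rewrite !addr0 cmul0r addr0. Qed.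

Lemma cmulNl x z : (- x) ** z = - (x ** z).
Proof. by rewrite -scaleN1r cmulZl scaleN1r. Qed.

Lemma cmulNr x z : z ** (- x) = - (z ** x).
Proof. by rewrite -scaleN1r cmulZr scaleN1r. Qed.

Lemma cmulBl x y z : (x - y) ** z = x ** z - y ** z.
Proof. by rewrite cmulDl cmulNl. Qed.

Lemma cmulBr x y z : z ** (x - y) = z ** x - z ** y.
Proof. by rewrite cmulDr cmulNr. Qed.

Lemma starD x y : star (x + y) = star x + star y.
Proof. by have := star_antilinear 1 x y; rewrite rmorph1 !scale1r. Qed.

Lemma star0 : star 0 = 0 :> A.
Proof. by apply: (addrI (star 0)); rewrite -starD !addr0. Qed.

Lemma starZ c x : star (c *: x) = Num.conj c *: star x.
Proof. by have := star_antilinear c x 0; rewrite star0 !addr0. Qed.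

Lemma starN x : star (- x) = - star x.
Proof. by rewrite -scaleN1r starZ rmorphN1 scaleN1r. Qed.

Lemma starB x y : star (x - y) = star x - star y.
Proof. by rewrite starD starN. Qed.

Lemma star_norm x : `|star x| = `|x|.
Proof.
suff h y : `|y| <= `|star y|.
  by apply/eqP; rewrite eq_le h andbT -{2}(starK x) h.
have [->|y0] := eqVneq y 0; first by rewrite normr0.
have := norm_cmul_le (star y) y; rewrite norm_star_cmul expr2.
by rewrite ler_pM2r// normr_gt0.
Qed.

End CStarTheory.

Section SquareRoot.
Variables (R : realType) (A : cstarAlgType R).
Implicit Types (x y z : A) (c : R[i]).

(** Closure under [star] is left out: the iteration below uses only linear combinations, products
    and limits, and selfadjointness is carried separately. *)
Definition mult_closed (S : set A) :=
  closed_subspace S /\ forall x y, S x -> S y -> S (x ** y).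

Fixpoint sqrt_iter (b : A) n : A :=
  if n is m.+1 then 2^-1 *: (b + sqrt_iter b m ** sqrt_iter b m) else 0.

(** The iteration at the scalar 1. For [|b| <= 1] it dominates the norms of the iterates and of
    their increments, so convergence reduces to a bounded monotone real sequence. *)
Fixpoint sqrt_bound n : R :=
  if n is m.+1 then 2^-1 * (1 + sqrt_bound m ^+ 2) else 0.

Lemma sqrt_bound_itv n : 0 <= sqrt_bound n <= 1.
Proof.
elim: n => [|n /andP[h0 h1]] /=; first by rewrite lexx ler01.
have : sqrt_bound n ^+ 2 <= 1 by rewrite exprn_ile1.
have : 0 <= sqrt_bound n ^+ 2 by rewrite exprn_ge0.
by move=> ? ?; apply/andP; split; lra.
Qed.

Lemma sqrt_boundS n : sqrt_bound n <= sqrt_bound n.+1.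
Proof. by have := sqr_ge0 (1 - sqrt_bound n); rewrite /=; nra. Qed.

Lemma norm_half x : `|2^-1 *: x| = 2^-1 * `|x|.
Proof. by rewrite normrZ ger0_norm// invr_ge0 ler0n. Qed.

Lemma half_complex : 2^-1 = (2^-1 : R)%:C.
Proof. by rewrite fmorphV rmorphMn. Qed.

Variable b : A.
Hypothesis b_le1 : `|b| <= 1.

Lemma sqrt_iter_norm n : `|sqrt_iter b n| <= (sqrt_bound n)%:C.
Proof.
elim: n => [|n ih] /=; first by rewrite normr0.
rewrite norm_half rmorphM /= -half_complex ler_pM2l ?invr_gt0 ?ltr0n//.
rewrite (le_trans (ler_normD _ _))// rmorphD rmorph1 lerD//.
by rewrite (le_trans (norm_cmul_le _ _))// rmorphXn expr2 ler_pM.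
Qed.

Lemma sqrt_iter_le1 n : `|sqrt_iter b n| <= 1.
Proof.
rewrite (le_trans (sqrt_iter_norm n))// -(rmorph1 (real_complex R)) lecR.
by have /andP[] := sqrt_bound_itv n.
Qed.

Lemma sqrt_iterS n :
  `|sqrt_iter b n.+1 - sqrt_iter b n| <= (sqrt_bound n.+1 - sqrt_bound n)%:C.
Proof.
elim: n => [|n ih].
  rewrite /= cmul0l addr0 subr0 norm_half expr0n /= addr0 mulr1 subr0.
  by rewrite -half_complex ler_piMr// invr_ge0 ler0n.
set u := sqrt_iter b n.+1 in ih *; set v := sqrt_iter b n in ih *.
(* The splitting u^2 - v^2 = u (u - v) + (u - v) v holds without commutativity, and the scalar
   majorant is split in the same way. *)
have -> : sqrt_iter b n.+2 - u = 2^-1 *: (u ** (u - v) + (u - v) ** v).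
  rewrite cmulBr cmulBl addrA subrK [sqrt_iter b n.+2]/= -/u.
  by rewrite {2}/u /= -/v -scalerBr opprD addrACA subrr add0r.
have -> : sqrt_bound n.+2 - sqrt_bound n.+1 = 2^-1 *
    (sqrt_bound n.+1 * (sqrt_bound n.+1 - sqrt_bound n)
     + (sqrt_bound n.+1 - sqrt_bound n) * sqrt_bound n).
  rewrite [sqrt_bound n.+2]/= -/(sqrt_bound n.+1).
  set p := sqrt_bound n.+1; have -> : p = 2^-1 * (1 + sqrt_bound n ^+ 2) by [].
  set q := sqrt_bound n.
  ring.
rewrite norm_half rmorphM /= -half_complex ler_pM2l ?invr_gt0 ?ltr0n//.
rewrite (le_trans (ler_normD _ _))// rmorphD lerD//.
  by rewrite (le_trans (norm_cmul_le _ _))// rmorphM ler_pM// sqrt_iter_norm.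
by rewrite (le_trans (norm_cmul_le _ _))// rmorphM ler_pM// sqrt_iter_norm.
Qed.

Lemma sqrt_iter_dist n m : (n <= m)%N ->
  `|sqrt_iter b m - sqrt_iter b n| <= (sqrt_bound m - sqrt_bound n)%:C.
Proof.
elim: m => [|m ih]; first by rewrite leqn0 => /eqP ->; rewrite !subrr normr0.
rewrite leq_eqVlt => /orP[/eqP ->|]; first by rewrite !subrr normr0.
rewrite ltnS => /ih h; rewrite -(subrKA (sqrt_iter b m)).
rewrite (le_trans (ler_normD _ _))// -(subrKA (sqrt_bound m)) rmorphD.
by rewrite lerD// sqrt_iterS.
Qed.

(** Past an index where [sqrt_bound] is within [e] of its supremum, the increments of the majorant,
    hence of the iterates, stay below [e]. *)
Lemma sqrt_iter_cauchy (e : R) : 0 < e ->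
  exists N, forall n, (N <= n)%N -> `|sqrt_iter b n - sqrt_iter b N| < e%:C.
Proof.
move=> e0.
have nd : {homo sqrt_bound : n m / (n <= m)%N >-> n <= m}.
  by apply: homo_leq => //; [exact: le_trans|exact: sqrt_boundS].
have ub : has_ubound (range sqrt_bound).
  by exists 1 => _ [n _ <-]; have /andP[] := sqrt_bound_itv n.
have hs : has_sup (range sqrt_bound) by split => //; exists 0, 0%N.
have [_ [N _ <-] hN] := sup_adherent e0 hs.
exists N => n Nn; apply: le_lt_trans (sqrt_iter_dist Nn) _.
rewrite ltcR ltrBlDr -ltrBlDl (le_lt_trans _ hN)// lerB//.
by apply: ub_le_sup => //; exists n.
Qed.

(** The equation says (1 - d)^2 = 1 - b in a form that needs no unit. The last clause is an
    induction principle for the limit: it carries selfadjointness and commutation relations over to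
    [d]. *)
Lemma sqrt_complement : exists d : A,
  [/\ d + d = b + d ** d, `|d| <= 1
    & forall S, closed S -> S 0 ->
        (forall x, S x -> S (2^-1 *: (b + x ** x))) -> S d].
Proof.
have /cvg_ex[d dP] : cvg (sqrt_iter b n @[n --> \oo]).
  apply: cauchy_cvg; apply: cauchy_exP => e /complex_gt0P[r r0 ->].
  have [N hN] := sqrt_iter_cauchy r0.
  exists (sqrt_iter b N); exists N => // n /= Nn.
  by rewrite -ball_normE /= distrC hN.
have near_d (e : R[i]) : 0 < e -> exists n,
    `|d - sqrt_iter b n| <= e /\ `|d - sqrt_iter b n.+1| <= e.
  move=> e0; have /cvgrPdist_le/(_ e e0)[N _ hN] := dP.
  by exists N; split; apply: hN => /=.
have d1 : `|d| <= 1.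
  apply/ler_addgt0Pr => e e0; have [n [+ _]] := near_d e e0.
  move=> h; rewrite -(subrK (sqrt_iter b n) d) (le_trans (ler_normD _ _))//.
  by rewrite [leRHS]addrC lerD// sqrt_iter_le1.
exists d; split => //.
- apply/eqP; rewrite -subr_eq0 -normr_eq0; apply/eqP.
  (* The factor 4 counts the error terms: [d - y] twice, then [d ** (d - x)] and [(d - x) ** x],
     whose other factors have norm at most 1. *)
  apply: (@ler0_small _ _ 4) => // e e0.
  have [n [h1 h2]] := near_d e e0.
  set x := sqrt_iter b n in h1; set y := sqrt_iter b n.+1 in h2.
  have yE : y + y = b + x ** x.
    by rewrite /y /= -/x -scalerDl -{1 2}[2^-1]mul1r -splitr scale1r.
  have x1 : `|x| <= 1 by exact: sqrt_iter_le1.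
  have -> : d + d - (b + d ** d) =
      ((d - y) + (d - y)) - (d ** (d - x) + (d - x) ** x).
    rewrite cmulBr cmulBl subrKA addrACA -opprD yE.
    by rewrite -[RHS]addrA -opprD addrACA subrr addr0.
  rewrite (le_trans (ler_normB _ _))//.
  have -> : 4 * e = (e + e) + (e + e) :> R[i] by ring.
  rewrite lerD// (le_trans (ler_normD _ _))// lerD//.
    by rewrite (le_trans (norm_cmul_le _ _))// -[leRHS]mul1r ler_pM.
  by rewrite (le_trans (norm_cmul_le _ _))// -[leRHS]mulr1 ler_pM.
- move=> S Scl S0 SS.
  apply: (@closed_cvg _ _ _ _ (sqrt_iter b) S Scl _ d dP).
  by apply: nearW => n; elim: n => [|n ih] //=; exact: SS.
Qed.

End SquareRoot.

Lemma sqrt_complement_mult_closed (R : realType) (A : cstarAlgType R)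
    (S : set A) (b d : A) : mult_closed S -> S b ->
  (forall S, closed S -> S 0 ->
        (forall x, S x -> S (2^-1 *: (b + x ** x))) -> S d) -> S d.
Proof.
move=> [[Scl S0 Slin] Smul] Sb; apply => // x Sx.
rewrite -[_ *: _]addr0; apply: (Slin) => //.
by rewrite -[b]scale1r; apply: Slin => //; exact: Smul.
Qed.

Lemma sqrt_complement_star (R : realType) (A : cstarAlgType R)
    (b d : A) : star b = b ->
  (forall S, closed S -> S 0 ->
        (forall x, S x -> S (2^-1 *: (b + x ** x))) -> S d) -> star d = d.
Proof.
move=> sb /(_ [set x | star x - x = 0]) h; apply/eqP; rewrite -subr_eq0.
apply/eqP; apply: h => [||x /= /subr0_eq sx].
- apply: (@closed_lipschitz_eq0 _ _ _ _ 2) => // x y.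
  have -> : star x - x - (star y - y) = star (x - y) - (x - y).
    by rewrite starB !opprB addrACA [RHS]addrACA [- x - _]addrC.
  by rewrite (le_trans (ler_normB _ _))// star_norm mulr_natl mulr2n.
- by rewrite /= star0 subrr.
- rewrite starZ starD starM sb sx.
  rewrite (_ : Num.conj 2^-1 = 2^-1) ?subrr//.
  by rewrite fmorphV rmorph_nat.
Qed.

Section Representations.
Variables (R : realType) (A : cstarAlgType R) (H : hilbertType R).
Variable pi : A -> {linear H -> H}.
Hypothesis rep : is_representation pi.
Implicit Types (a b d : A) (x y z : H) (c : R[i]).

Lemma repD a b x : pi (a + b) x = pi a x + pi b x.
Proof. by have := rep_linear rep 1 a b x; rewrite !scale1r. Qed.

Lemma rep0 x : pi 0 x = 0.
Proof. by apply: (addrI (pi 0 x)); rewrite -repD !addr0. Qed.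

Lemma repZ c a x : pi (c *: a) x = c *: pi a x.
Proof. by have := rep_linear rep c a 0 x; rewrite rep0 !addr0. Qed.

Lemma repN a x : pi (- a) x = - pi a x.
Proof. by rewrite -scaleN1r repZ scaleN1r. Qed.

Lemma repB a b x : pi (a - b) x = pi a x - pi b x.
Proof. by rewrite repD repN. Qed.

Lemma rep_adj a x y : dotp (pi (star a) x) y = dotp x (pi a y).
Proof. by rewrite rep_star// starK. Qed.

(* For |a| <= 1 the relation 1 - a^* a = (1 - d)^2 makes
   |x|^2 - |pi a x|^2 the square |x - pi d x|^2. *)
Lemma rep_contraction a x : `|a| <= 1 -> `|pi a x| <= `|x|.
Proof.
move=> a1.
have b1 : `|star a ** a| <= 1 by rewrite norm_star_cmul exprn_ile1.
have [d [dE _ dS]] := sqrt_complement b1.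
have sd : star d = d.
  by apply: sqrt_complement_star dS; rewrite starM starK.
rewrite -(@ler_pXn2r _ 2) ?nnegrE// -subr_ge0.
have -> : `|x| ^+ 2 - `|pi a x| ^+ 2 = `|x - pi d x| ^+ 2; last first.
  by rewrite exprn_ge0.
rewrite !normr_dotp dotpBl !dotpBr (rep_star rep d) sd.
rewrite (rep_star rep a) -(rep_mul rep) -(rep_adj d) sd.
have -> : star a ** a = d + d - d ** d by rewrite dE addrK.
rewrite repB repD (rep_mul rep) dotpBr dotpDr.
by rewrite !(rep_star rep d) sd; ring.
Qed.

Lemma rep_norm_le a x : `|pi a x| <= `|a| * `|x|.
Proof.
have [->|a0] := eqVneq a 0; first by rewrite rep0 !normr0 mul0r.
have a1 : 0 < `|a| by rewrite normr_gt0.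
have := @rep_contraction (`|a|^-1 *: a) x.
rewrite normrZ normfV normr_id mulVf ?normr_eq0// => /(_ (lexx _)).
by rewrite repZ normrZ normfV normr_id ler_pdivrMl.
Qed.

End Representations.

Lemma closed_forall (T : topologicalType) (I : Type) (P : I -> set T) :
  (forall i, closed (P i)) -> closed [set x | forall i, P i x].
Proof.
move=> h x hx i; apply: h => U /hx[y [Py Uy]]; by exists y; split.
Qed.

Lemma norm_projection_le1 (R : realType) (A : cstarAlgType R) (p : A) :
  projection p -> `|p| <= 1.
Proof.
move=> [pp sp]; have := norm_star_cmul p; rewrite sp pp.
have [->|p0] := eqVneq p 0; first by rewrite normr0 ler01.
rewrite expr2 -[X in X = _]mulr1 => /mulfI -> //.
by rewrite normr_eq0.
Qed.

(* For selfadjoint commuting c, e with c^2 + e^2 = p the element u = c + ie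
   is unitary in the corner of p, and e is the imaginary part of u. *)
Lemma norm_cosine_le1 (R : realType) (A : cstarAlgType R) (p c e : A) :
  projection p -> star c = c -> star e = e -> c ** e = e ** c ->
  c ** c + e ** e = p -> `|e| <= 1.
Proof.
move=> pp sc se ce cep; pose u := c + 'i *: e.
have su : star u = c - 'i *: e.
  by rewrite /u starD starZ sc se conjCi scaleNr.
have uu : star u ** u = p.
  rewrite su /u cmulBl !cmulDr !cmulZl !cmulZr ce scalerA -expr2 sqrCi.
  by rewrite scaleN1r opprD opprK addrA addrK.
have u1 : `|u| <= 1.
  rewrite -(@expr_le1 _ 2)// -norm_star_cmul uu.
  exact: norm_projection_le1.
have eE : e = (2^-1 * - 'i) *: (u - star u).
  have -> : u - star u = ('i + 'i) *: e.
    by rewrite su opprB /u addrCA addrAC subrr add0r scalerDl.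
  rewrite scalerA -mulrA mulrDr mulNr -expr2 sqrCi opprK.
  by rewrite mulVf ?scale1r// pnatr_eq0.
rewrite eE normrZ normrM normrN normCi mulr1.
rewrite normfV normr_nat ler_pdivrMl ?ltr0n// mulr1.
by rewrite (le_trans (ler_normB _ _))// star_norm mulr2n lerD.
Qed.

Lemma mult_closedB (R : realType) (A : cstarAlgType R) (S : set A) x y :
  mult_closed S -> S x -> S y -> S (x - y).
Proof.
by move=> [[_ _ Slin] _] Sx Sy; rewrite -scaleN1r addrC; exact: Slin.
Qed.

(** * Schur's lemma for a selfadjoint element in the corner of a projection *)

Section Schur.
Variables (R : realType) (A : cstarAlgType R) (H : hilbertType R).
Variable pi : A -> {linear H -> H}.
Hypothesis rep : is_representation pi.
Variables (p h : A) (V : set A).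
Hypothesis p_proj : projection p.
Hypothesis h_star : star h = h.
Hypothesis ph : p ** h = h.
Hypothesis hp : h ** p = h.
Hypothesis pV : forall v, V v -> p ** v = v.
Hypothesis V_transitive : forall x y, pi p x = x -> pi p y = y ->
  x <> 0 -> y <> 0 -> exists2 v, V v & dotp (pi v x) y <> 0.
Hypothesis V_comm : forall v x, V v -> pi p x = x ->
  pi h (pi v x) = pi v (pi h x).

(** The relations are differences equal to 0 so that each defines a closed set by a Lipschitz bound.
    Commutation with [V] is asked of operators on the range of [pi p] only, since words in a graph
    algebra are known to commute only there; the relation [p ** a = a] keeps products inside that
    range. *)
Definition corner_commutant (c : A) : set A :=
  [set a | [/\ p ** a - a = 0, a ** p - a = 0, a ** c - c ** a = 0
    & forall v x, V v -> pi p x = x -> pi a (pi v x) - pi v (pi a x) = 0]].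

Lemma corner_commutant_mult_closed c : mult_closed (corner_commutant c).
Proof.
have sub4 (x y x' y' : A) : x - y - (x' - y') = x - x' - (y - y').
  by rewrite !opprB addrACA [RHS]addrACA [- y - _]addrC.
have sub4H (x y x' y' : H) : x - y - (x' - y') = x - x' - (y - y').
  by rewrite !opprB addrACA [RHS]addrACA [- y - _]addrC.
split; first split.
- have -> : corner_commutant c = [set a | p ** a - a = 0] `&`
      [set a | a ** p - a = 0] `&` [set a | a ** c - c ** a = 0] `&`
      [set a | forall v x, V v -> pi p x = x ->
         pi a (pi v x) - pi v (pi a x) = 0].
    by apply/seteqP; split => a; [move=> []|move=> [[[]]]].
  apply: closedI; first apply: closedI; first apply: closedI.
  + apply: (@closed_lipschitz_eq0 _ _ _ _ (`|p| + 1)); first exact: addr_ge0.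
    move=> x y.
    rewrite sub4 -cmulBr (le_trans (ler_normB _ _))// mulrDl mul1r lerD//.
    exact: norm_cmul_le.
  + apply: (@closed_lipschitz_eq0 _ _ _ _ (`|p| + 1)); first exact: addr_ge0.
    move=> x y.
    rewrite sub4 -cmulBl (le_trans (ler_normB _ _))// mulrDl mul1r lerD//.
    by rewrite mulrC norm_cmul_le.
  + apply: (@closed_lipschitz_eq0 _ _ _ _ (`|c| + `|c|)); first exact: addr_ge0.
    move=> x y; rewrite sub4 -cmulBl -cmulBr (le_trans (ler_normB _ _))//.
    by rewrite mulrDl lerD// ?norm_cmul_le// mulrC norm_cmul_le.
  + apply: closed_forall => v; apply: closed_forall => x.
    apply: closed_forall => _; apply: closed_forall => _.
    apply: (@closed_lipschitz_eq0 _ _ _ _ (`|pi v x| + `|v| * `|x|)).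
      by rewrite addr_ge0// mulr_ge0.
    move=> a b; rewrite sub4H -repB// -linearB -repB// (le_trans (ler_normB _ _))//.
    rewrite mulrDl lerD//; first by rewrite mulrC rep_norm_le.
    rewrite (le_trans (rep_norm_le rep _ _))// -mulrA ler_wpM2l//.
    by rewrite mulrC rep_norm_le.
- split; rewrite ?cmul0l ?cmul0r ?subrr// => v z _ _.
  by rewrite !rep0// linear0 subrr.
- move=> k x y [/subr0_eq x1 /subr0_eq x2 /subr0_eq x3 x4].
  move=> [/subr0_eq y1 /subr0_eq y2 /subr0_eq y3 y4].
  split; rewrite ?cmul_linearl ?cmul_linearr ?x1 ?x2 ?x3 ?y1 ?y2 ?y3 ?subrr//.
  move=> v z Vv pz; rewrite !(rep_linear rep) linearP.
  by rewrite (subr0_eq (x4 v z Vv pz)) (subr0_eq (y4 v z Vv pz)) subrr.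
- move=> x y [/subr0_eq x1 /subr0_eq x2 /subr0_eq x3 x4].
  move=> [/subr0_eq y1 /subr0_eq y2 /subr0_eq y3 y4]; split.
  + by rewrite cmulA x1 subrr.
  + by rewrite -cmulA y2 subrr.
  + by rewrite -cmulA y3 cmulA x3 -cmulA subrr.
  + move=> v z Vv pz.
    have yz : pi p (pi y z) = pi y z by rewrite -(rep_mul rep) y1.
    rewrite !(rep_mul rep).
    by rewrite (subr0_eq (y4 v z Vv pz)) x4.
Qed.

Lemma corner_commutant_p c : p ** c = c -> c ** p = c -> corner_commutant c p.
Proof.
have [pp _] := p_proj.
move=> pc cp; split; rewrite ?pp ?pc ?cp ?subrr// => v x Vv px.
by rewrite -(rep_mul rep) pV// px subrr.
Qed.

(** The iteration yields only square roots of 1 - b, so it is used twice: once to get e with e^2 = p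
    - c^2, and once more to get a root of p - e^2 = c^2. The second use needs [|e| <= 1], which
    [norm_cosine_le1] supplies. Thus [p - d] is the absolute value of [c]; the bound [|d| <= 1]
    later replaces its positivity. *)
Lemma corner_sqrt (c : A) : star c = c -> p ** c = c -> c ** p = c ->
  `|c| <= 1 -> corner_commutant c c -> exists d : A,
  [/\ star d = d, corner_commutant c d, `|d| <= 1 &
     (p - d) ** (p - d) = c ** c].
Proof.
move=> sc pc cp c1 Cc; have [pp sp] := p_proj.
have Cm := corner_commutant_mult_closed c; have [_ Cmul] := Cm.
have Cp := corner_commutant_p pc cp.
have sqE d : p ** d = d -> d ** p = d ->
    (p - d) ** (p - d) = p - (d + d - d ** d).
  move=> pd dp; rewrite cmulBl !cmulBr pp pd dp.
  by rewrite -[LHS]addrA -opprD addrA.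
have cc1 : `|c ** c| <= 1.
  by rewrite (le_trans (norm_cmul_le _ _))// mulr_ile1.
have [d [dE _ dS]] := sqrt_complement cc1.
have Cd := sqrt_complement_mult_closed Cm (Cmul _ _ Cc Cc) dS.
have sd : star d = d by apply: sqrt_complement_star dS; rewrite starM sc.
have [/subr0_eq pd /subr0_eq dp /subr0_eq dc _] := Cd.
set e := p - d.
have ee : e ** e = p - c ** c by rewrite sqE// dE addrK.
have se : star e = e by rewrite starB sp sd.
have e1 : `|e| <= 1.
  apply: (norm_cosine_le1 p_proj sc se); last by rewrite ee addrC subrK.
  by rewrite cmulBl cmulBr dc pc cp.
have ee1 : `|e ** e| <= 1.
  by rewrite (le_trans (norm_cmul_le _ _))// mulr_ile1.
have [d' [d'E d'1 d'S]] := sqrt_complement ee1.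
have Ce : corner_commutant c e by exact: mult_closedB.
have Cd' := sqrt_complement_mult_closed Cm (Cmul _ _ Ce Ce) d'S.
exists d'; split => //.
  by apply: sqrt_complement_star d'S; rewrite starM se.
have [/subr0_eq pd' /subr0_eq d'p _ _] := Cd'.
by rewrite sqE// d'E addrK ee opprB addrC subrK.
Qed.

Lemma schur x : pi p x = x -> exists k : R[i], pi h x = k *: x.
Proof.
move=> px; have [pp sp] := p_proj.
have [->|/eqP x0] := eqVneq x 0; first by exists 0; rewrite linear0 scaler0.
have xx0 : dotp x x != 0 :> R[i] by apply/eqP => /dotp_eq0.
pose m := dotp (pi h x) x / dotp x x.
have mC : Num.conj m = m.
  rewrite /m fmorph_div /=; congr (_ / _); last by rewrite -dotpC.
  by rewrite -[LHS]dotpC (rep_star rep) h_star.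
pose c0 := h - m *: p.
suff c0x : pi c0 x = 0.
  by exists m; apply/eqP; rewrite -subr_eq0 -[in m *: _]px -repZ// -repB// c0x.
have [->|c0n] := eqVneq c0 0; first by rewrite rep0.
pose r := `|c0|^-1; pose c := r *: c0.
have r0 : r != 0 by rewrite invr_eq0 normr_eq0.
suff : pi c x = 0.
  by rewrite repZ// => /eqP; rewrite scaler_eq0 (negbTE r0) /= => /eqP.
have c1 : `|c| <= 1 by rewrite normrZ normfV normr_id mulVf// normr_eq0.
have sc : star c = c.
  rewrite starZ starB starZ mC h_star sp; congr (_ *: _).
  by apply: conj_Creal; rewrite realV normr_real.
have pc : p ** c = c by rewrite cmulZr cmulBr cmulZr ph pp.
have cp : c ** p = c by rewrite cmulZl cmulBl cmulZl hp pp.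
have Cc : corner_commutant c c.
  split; rewrite ?pc ?cp ?subrr// => v y Vv py.
  rewrite !repZ// !repB// !repZ// V_comm// py -(rep_mul rep p) pV//.
  by rewrite [pi v (_ *: _)]linearZZ [pi v (_ - _)]linearB [pi v (_ *: _)]linearZZ subrr.
have [d [sd Cd d1 gg]] := corner_sqrt sc pc cp c1 Cc.
have [/subr0_eq pd /subr0_eq dp /subr0_eq dc dV] := Cd.
have cxx : dotp (pi c x) x = 0.
  rewrite repZ// repB// repZ// px dotpZl dotpBl dotpZl divfK//.
  by rewrite subrr mulr0.
(* [g] is the absolute value of [c], kept opaque. *)
move: gg; have [g gE] : exists g, g = p - d by exists (p - d).
rewrite -gE => gg; clearbody c.
have prod0 : (g - c) ** (g + c) = 0.
  have gc : g ** c = c ** g by rewrite gE cmulBl cmulBr pc cp dc.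
  by rewrite (cmulBl g c) (cmulDr g c g) (cmulDr g c c) gg gc [c ** g + _]addrC subrr.
have pg : p ** g = g by rewrite gE cmulBr pp pd.
have gK y : pi p (pi (g + c) y) = pi (g + c) y.
  by rewrite -(rep_mul rep) (cmulDr g c p) pg pc.
have gK' y : pi p (pi (g - c) y) = pi (g - c) y.
  by rewrite -(rep_mul rep) (cmulBr g c p) pg pc.
(* If both vectors were nonzero, some [v] in [V] would pair v (g + c) x with (g - c) x. Moving g - c
   across the inner product and past v leaves v (g - c) (g + c) x = 0. *)
have dich : pi (g + c) x = 0 \/ pi (g - c) x = 0.
  apply: contrapT => /not_orP[n1 n2].
  have [v Vv] := V_transitive (gK x) (gK' x) n1 n2; apply.
  have sgc : star (g - c) = g - c by rewrite gE !starB sp sd sc.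
  rewrite -(rep_adj rep) sgc.
  have Cgc : corner_commutant c (g - c).
    have Cm := corner_commutant_mult_closed c.
    by rewrite gE; do 2!apply: mult_closedB => //; exact: corner_commutant_p.
  have [_ _ _ gV] := Cgc.
  rewrite (subr0_eq (gV _ _ Vv (gK x))) -(rep_mul rep (g - c) (g + c)) prod0.
  by rewrite rep0// linear0 dotp0l.
have gx : pi g x = 0.
  have gxx : dotp (pi g x) x = 0.
    case: dich => [|]; [rewrite repD//|rewrite repB//].
      by move/eqP; rewrite addr_eq0 => /eqP ->; rewrite dotpNl cxx oppr0.
    by move/subr0_eq ->.
  have dxx : dotp (pi d x) x = dotp x x.
    by apply/esym/eqP; rewrite -subr_eq0 -dotpBl -{1}px -repB// -gE gxx.
  (* Equality case of a contraction: <d x, x> = |x|^2 gives |x - d x|^2 = |d x|^2 - |x|^2 <= 0. *)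
  rewrite gE repB// px; apply: dotp_eq0; apply/eqP.
  have xdx : dotp x (pi d x) = dotp x x by rewrite dotpC dxx -dotpC.
  rewrite eq_le dotp_ge0 andbT dotpBl !dotpBr dxx xdx subrr sub0r opprB.
  by rewrite -!normr_dotp subr_le0 ler_pXn2r ?nnegrE// rep_contraction.
case: dich; [rewrite repD//|rewrite repB//]; rewrite gx; first by rewrite add0r.
by rewrite sub0r => /eqP; rewrite oppr_eq0 => /eqP.
Qed.

End Schur.

Lemma schur_commutative (R : realType) (A : cstarAlgType R) (H : hilbertType R)
    (pi : A -> {linear H -> H}) (p : A) (V : set A) :
  is_representation pi -> projection p ->
  (forall v, V v -> [/\ p ** v = v, v ** p = v & V (star v)]) ->
  (forall x y, pi p x = x -> pi p y = y -> x <> 0 -> y <> 0 ->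
     exists2 v, V v & dotp (pi v x) y <> 0) ->
  (forall v w x, V v -> V w -> pi p x = x -> pi v (pi w x) = pi w (pi v x)) ->
  forall v x, V v -> pi p x = x -> exists k : R[i], pi v x = k *: x.
Proof.
move=> rep pp Vp Vt Vc v x Vv px.
have [pv vp Vs] := Vp v Vv; have [psv svp _] := Vp _ Vs.
have pV w : V w -> p ** w = w by move=> /Vp[].
have key h : star h = h -> p ** h = h -> h ** p = h ->
    (forall w y, V w -> pi p y = y -> pi h (pi w y) = pi w (pi h y)) ->
    exists k : R[i], pi h x = k *: x.
  by move=> sh ph hp hV; exact: (@schur _ _ _ _ rep p h V pp sh ph hp pV Vt hV).
have [||||k1 hk1] := key (v + star v).
- by rewrite starD starK addrC.
- by rewrite cmulDr pv psv.
- by rewrite cmulDl vp svp.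
- by move=> w y Vw py; rewrite !repD// (Vc v w)// (Vc (star v) w)// linearD.
have [||||k2 hk2] := key ('i *: (v - star v)).
- by rewrite starZ starB starK conjCi scaleNr -scalerN opprB.
- by rewrite cmulZr cmulBr pv psv.
- by rewrite cmulZl cmulBl vp svp.
- move=> w y Vw py; rewrite !repZ// !repB// (Vc v w)// (Vc (star v) w)//.
  by rewrite [pi w (_ *: _)]linearZZ [pi w (_ - _)]linearB.
exists (2^-1 * (k1 - 'i * k2)).
have vE : v = 2^-1 *: ((v + star v) - 'i *: ('i *: (v - star v))).
  rewrite scalerA -expr2 sqrCi scaleN1r opprK addrACA subrr addr0 -mulr2n.
  by rewrite -[v *+ 2]scaler_nat scalerA mulVf ?scale1r// pnatr_eq0.
rewrite {1}vE repZ// repB// hk1 repZ// hk2.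
by rewrite -scalerA scalerBl scalerA.
Qed.

(** * Walks and tail equivalence *)

Lemma mkseq_add (T : Type) (q : nat -> T) i k :
  mkseq q (i + k) = mkseq q i ++ mkseq (fun l => q (i + l)%N) k.
Proof.
by rewrite /mkseq iotaD map_cat add0n -[X in iota X k]addn0 iotaDl -map_comp.
Qed.

Lemma mkseq_cons (T : Type) (q : nat -> T) k :
  mkseq q k.+1 = q 0%N :: mkseq (fun l => q l.+1) k.
Proof. by rewrite -addn1 addnC mkseq_add. Qed.

Section Walks.
Variable E : digraph.
Implicit Types (v w : vertex E) (m n : seq (edge E)) (q r : nat -> edge E).

Fixpoint walk v m w : bool :=
  if m is e :: m' then (origin e == v) && walk (terminus e) m' w else v == w.

Lemma walk_cat v m n w :
  walk v (m ++ n) w <-> exists2 u, walk v m u & walk u n w.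
Proof.
elim: m v => [|e m ih] v /=.
  by split=> [h|[u /eqP -> //]]; exists v.
split=> [/andP[-> /ih[u mu nw]]|[u /andP[-> mu] nw]]; first by exists u.
by apply/ih; exists u.
Qed.

Lemma walk_inj v m w w' : walk v m w -> walk v m w' -> w = w'.
Proof.
elim: m v => [|e m ih] v /=; first by move=> /eqP <- /eqP.
by move=> /andP[_ /ih h] /andP[_ /h].
Qed.

Lemma walk_step e0 v m w k : walk v m w -> (k.+1 < size m)%N ->
  terminus (nth e0 m k) = origin (nth e0 m k.+1).
Proof.
elim: m v k => [//|e m ih] v [|k] /= /andP[_ h]; rewrite ltnS => km.
  by case: m h km {ih} => [//|f m] /= /andP[/eqP].
exact: ih h km.
Qed.

Lemma walk_start e0 v m w : walk v m w -> (0 < size m)%N ->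
  origin (nth e0 m 0) = v.
Proof. by case: m => [//|e m] /= /andP[/eqP]. Qed.

Lemma walk_end e0 v m w k : walk v m w -> k.+1 = size m ->
  terminus (nth e0 m k) = w.
Proof.
elim: m v k => [//|e m ih] v [|k] /= /andP[_ h] [].
  by move/esym/size0nil => m0; move: h; rewrite m0 => /eqP.
exact: ih h.
Qed.

Definition concat m r : nat -> edge E :=
  fun k => if (k < size m)%N then nth (r 0%N) m k else r (k - size m)%N.

Definition pshift k q : nat -> edge E := fun i => q (k + i)%N.

Lemma concat_pshift m r i : concat m r (size m + i)%N = r i.
Proof. by rewrite /concat ltnNge leq_addr /= addKn. Qed.

Lemma concat_infinite v m w r : walk v m w -> infinite_paths r ->
  path_origin r = w -> infinite_paths (concat m r).
Proof.
move=> mw rp rw k; rewrite /concat.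
have [km|km] := ltnP k.+1 (size m).
  by rewrite (ltn_trans (ltnSn k) km) (walk_step _ mw).
have [km'|km'] := ltnP k (size m); last by rewrite subSn.
have ks : k.+1 = size m by apply/eqP; rewrite eqn_leq km' km.
by rewrite (walk_end _ mw ks) -rw ks subnn.
Qed.

Lemma concat_origin v m w r : walk v m w ->
  path_origin r = w -> path_origin (concat m r) = v.
Proof.
move=> mw rw; rewrite /path_origin /concat.
have [m0|] := ltnP 0 (size m); first exact: walk_start mw m0.
rewrite leqn0 => /nilP m0; move: mw; rewrite m0 /= => /eqP ->.
by rewrite -rw.
Qed.

Lemma pshift_infinite k q : infinite_paths q -> infinite_paths (pshift k q).
Proof. by move=> qp i; rewrite /pshift addnS. Qed.

Lemma walk_mkseq q k : infinite_paths q ->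
  walk (path_origin q) (mkseq q k) (path_origin (pshift k q)).
Proof.
move=> qp; elim: k q qp => [|k ih] q qp.
  by rewrite /= /path_origin /pshift add0n.
rewrite /mkseq /= eqxx /= (iotaDl 1 0) -map_comp qp.
exact: (ih _ (pshift_infinite 1 qp)).
Qed.

Lemma mkseq_pshift_add q i k :
  mkseq q (i + k) = mkseq q i ++ mkseq (pshift i q) k.
Proof. exact: mkseq_add. Qed.

Lemma pshift_pshift q k i : pshift i (pshift k q) = pshift (k + i) q.
Proof. by apply/funext => j; rewrite /pshift addnA. Qed.

Lemma tail_equiv_refl q : tail_equiv q q.
Proof. by exists 0%N, 0%N. Qed.

Lemma tail_equiv_sym q r : tail_equiv q r -> tail_equiv r q.
Proof. by move=> [j [k h]]; exists k, j => i; rewrite h. Qed.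

Lemma tail_equiv_trans q r t :
  tail_equiv q r -> tail_equiv r t -> tail_equiv q t.
Proof.
move=> [j [k h]] [j' [k' h']]; exists (j + j')%N, (k' + k)%N => i.
by rewrite -addnA h addnA [(k + j')%N]addnC -addnA h' addnA.
Qed.

Lemma tail_equiv_concat m q k : tail_equiv q (concat m (pshift k q)).
Proof. by exists k, (size m) => i; rewrite concat_pshift. Qed.

(* A vertex system in which every vertex has two incomparable walks to a common
   vertex yields the path q = a_0 a_1 a_2 ... , and replacing a_n by b_n gives
   infinitely many paths with the same origin and the same tail. *)
Lemma branching_not_M (L : vertex E -> Prop) e0 v0 : L v0 ->
  (forall w, L w -> exists (a b : seq (edge E)) w', [/\ L w', walk w a w', walk w b w'
     & exists k, [/\ (k < size a)%N, (k < size b)%N & nth e0 a k <> nth e0 b k]]) ->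
  ~ condition_M E.
Proof.
move=> Lv0 branch M.
pose LT := {w | L w}.
pose good (w : LT) (abw : seq (edge E) * seq (edge E) * LT * nat) :=
  let: (a, b, w', k) := abw in
  [/\ walk (sval w) a (sval w'), walk (sval w) b (sval w'), (k < size a)%N,
     (k < size b)%N & nth e0 a k <> nth e0 b k].
have /choice[step stepP] : forall w : LT, exists abw, good w abw.
  move=> -[w Lw].
  have [a [b [w' [Lw' wa wb [k [ka kb abk]]]]]] := branch w Lw.
  by exists (a, b, exist _ w' Lw', k).
(* Iterated choice: vertices w_0 = v0, w_1, ... where w_i is joined to w_(i+1) by both [an i] and
   [bn i]. *)
pose wn (i : nat) := iter i (fun w : LT => (step w).1.2) (exist L v0 Lv0).
pose an i := (step (wn i)).1.1.1; pose bn i := (step (wn i)).1.1.2.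
pose kn i := (step (wn i)).2.
have nP (n : nat) : [/\ walk (sval (wn n)) (an n) (sval (wn n.+1)),
    walk (sval (wn n)) (bn n) (sval (wn n.+1)), (kn n < size (an n))%N,
    (kn n < size (bn n))%N & nth e0 (an n) (kn n) <> nth e0 (bn n) (kn n)].
  have := stepP (wn n); rewrite /good /an /bn /kn [wn n.+1]/= -/(wn n).
  by case: (step (wn n)) => -[[a b] w'] k.
pose nu := fix nu (n : nat) := if n is n'.+1 then nu n' ++ an n' else [::].
have nuw (n : nat) : walk v0 (nu n) (sval (wn n)).
  elim: n => [|n ih] /=; first exact: eqxx.
  by apply/walk_cat; exists (sval (wn n)) => //; have [] := nP n.
have nu_le (n m : nat) : (n <= m)%N -> exists t, nu m = nu n ++ t.
  elim: m => [|m ih]; first by rewrite leqn0 => /eqP ->; exists [::]; rewrite cats0.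
  rewrite leq_eqVlt => /orP[/eqP ->|]; first by exists [::]; rewrite cats0.
  by rewrite ltnS => /ih[t e]; exists (t ++ an m); rewrite /= e catA.
have nu_size (n : nat) : (n <= size (nu n))%N.
  elim: n => [//|n ih] /=; rewrite size_cat -addn1 leq_add//.
  by have [_ _ + _ _] := nP n; case: (an n).
(* No [an i] is empty, so [nu k.+1] has more than [k] letters and the default [e0] is never read. *)
pose q (k : nat) := nth e0 (nu k.+1) k.
have qE (n k : nat) : (k < size (nu n))%N -> nth e0 (nu n) k = q k.
  move=> kn'; rewrite /q; have [nk|kn1] := leqP n k.+1.
    by have [t ->] := nu_le _ _ nk; rewrite nth_cat kn'.
  have [t ->] := nu_le _ _ (ltnW kn1).
  by rewrite nth_cat (leq_trans _ (nu_size k.+1)).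
have qp : infinite_paths q.
  move=> k; have ks : (k.+1 < size (nu k.+2))%N by exact: nu_size.
  by rewrite -!(qE k.+2)//; [exact: walk_step (nuw _) ks|exact: ltnW].
have qw (n : nat) : path_origin (pshift (size (nu n)) q) = sval (wn n).
  rewrite /path_origin /pshift addn0.
  have [_ _ kn0 _ _] := nP n; have a0 := leq_ltn_trans (leq0n _) kn0.
  have := qE n.+1 (size (nu n)); rewrite /= size_cat -[ltnLHS]addn0 ltn_add2l.
  move=> /(_ a0) <-; rewrite nth_cat ltnn subnn.
  by apply: walk_start => //; have [] := nP n; eauto.
pose q' (n : nat) := concat (nu n ++ bn n) (pshift (size (nu n.+1)) q).
have wb (n : nat) : walk v0 (nu n ++ bn n) (sval (wn n.+1)).
  by apply/walk_cat; exists (sval (wn n)) => //; have [] := nP n.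
have q'S (n : nat) : (path_class q `&` [set r | path_origin r = v0]) (q' n).
  split; last exact: concat_origin (wb n) (qw _).
  split; last exact: tail_equiv_concat.
  by apply: concat_infinite (wb n) _ (qw _); exact: pshift_infinite.
have q'q (n k : nat) : (k < size (nu n))%N -> q' n k = q k.
  move=> kn'; rewrite /q' /concat size_cat ltn_addr// -(qE n)//.
  by rewrite nth_cat kn'; apply: set_nth_default.
have q'nq (n : nat) : q' n (size (nu n) + kn n)%N <> q (size (nu n) + kn n)%N.
  have [_ _ ka kb ab] := nP n.
  rewrite /q' /concat size_cat ltn_add2l kb -(qE n.+1); last first.
    by rewrite /= size_cat ltn_add2l.
  rewrite (erefl : nu n.+1 = nu n ++ an n) !nth_cat ltnNge leq_addr /= addKn => h.
  apply: ab.
  by rewrite -h; apply: set_nth_default.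
have q'inj : injective q'.
  (* At position [size (nu n) + kn n] the path [q' n'] still follows [q], whereas [q' n] has left
     it. *)
  suff lt (n n' : nat) : (n < n')%N -> q' n <> q' n'.
    move=> n n' e; have [/lt|/lt|//] := ltngtP n n' => h.
      by case: h.
    by case: h.
  move=> nn' e; apply: (@q'nq n); rewrite e q'q//.
  have [_ _ ka _ _] := nP n; have [t ->] := nu_le _ _ nn'.
  by rewrite size_cat /= size_cat -addnA ltn_add2l ltn_addr.
have := M v0 q qp => /(finite_preimage (f := q')) h.
apply: infinite_nat; have := h _.
rewrite (_ : _ @^-1` _ = setT); first by apply; move=> ? ? _ _; exact: q'inj.
by apply/seteqP; split => // i _; exact: q'S.
Qed.

End Walks.

(** * Irreducible representations of Cuntz-Krieger families *)

Lemma lipschitz_continuous (K : numFieldType) (V W : normedModType K)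
    (f : V -> W) (C : K) :
  0 <= C -> (forall x y, `|f x - f y| <= C * `|x - y|) -> continuous f.
Proof.
move=> C0 fC x; apply/cvgrPdist_lt => e e0.
have C1 : 0 < C + 1 by rewrite ltr_wpDl.
near=> y; rewrite (le_lt_trans (fC x y))//.
rewrite (@le_lt_trans _ _ ((C + 1) * `|x - y|)) ?ler_wpM2r ?lerDl//.
rewrite -ltr_pdivlMl//; near: y; apply: cvgr_dist_lt => //.
by rewrite mulr_gt0// invr_gt0.
Unshelve. all: by end_near. Qed.

Lemma closed_lipschitz_preimage (K : numFieldType) (V W : normedModType K)
    (f : V -> W) (C : K) (S : set W) :
  0 <= C -> (forall x y, `|f x - f y| <= C * `|x - y|) ->
  closed S -> closed (f @^-1` S).
Proof.
move=> C0 fC; apply: preimage_closed => x _.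
exact: lipschitz_continuous C0 fC x.
Qed.

Section GraphOperators.
Variables (R : realType) (E : digraph) (A : cstarAlgType R).
Variables (p : vertex E -> A) (s : edge E -> A).
Hypothesis hrow : row_finite E.
Hypothesis hA : is_graph_algebra p s.
Variables (H : hilbertType R) (pi : A -> {linear H -> H}).
Hypothesis rep : is_representation pi.
Hypothesis irr : irreducible pi.
Implicit Types (v w : vertex E) (e f : edge E) (m n : seq (edge E)) (x y z : H).

Let ck := ga_cuntz_krieger hA.
Local Notation P v := (pi (p v)).
Local Notation T e := (pi (s e)).
Local Notation T' e := (pi (star (s e))).

Lemma PP v x : P v (P v x) = P v x.
Proof. by rewrite -(rep_mul rep); have [-> _] := ck_projection ck v. Qed.

Lemma P_sym v x y : dotp (P v x) y = dotp x (P v y).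
Proof. by rewrite (rep_star rep); have [_ ->] := ck_projection ck v. Qed.

Lemma P_orth v w x : v <> w -> P v (P w x) = 0.
Proof. by move=> vw; rewrite -(rep_mul rep) (ck_orthogonal ck)// rep0. Qed.

Lemma T'T e x : T' e (T e x) = P (terminus e) x.
Proof. by rewrite -(rep_mul rep) (ck_source ck). Qed.

Lemma T_adj e x y : dotp (T e x) y = dotp x (T' e y).
Proof. exact: rep_star. Qed.

Lemma T'_adj e x y : dotp (T' e x) y = dotp x (T e y).
Proof. exact: rep_adj. Qed.

Lemma TP e x : T e (P (terminus e) x) = T e x.
Proof. by rewrite -T'T -!(rep_mul rep) (ck_partial_isometry ck). Qed.

Lemma PT' e x : P (terminus e) (T' e x) = T' e x.
Proof. by apply: dotp_ext => y; rewrite P_sym !T'_adj TP. Qed.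

Lemma P_sum v x : P v x = \sum_(e <- fset_set (emitted v)) T e (T' e x).
Proof.
have fv := hrow v; rewrite -(ck_range ck) fsbig_finite//=.
elim/big_rec2: _ => [|e y a _ <-]; first by rewrite rep0.
by rewrite repD// rep_mul.
Qed.

Lemma in_emitted v e : (e \in (fset_set (emitted v) : seq (edge E))) = (origin e == v).
Proof.
rewrite in_fset_set; last exact: hrow.
by apply/idP/idP; rewrite inE /emitted /= => /eqP.
Qed.

Lemma P_norm v x :
  `|P v x| ^+ 2 = \sum_(e <- fset_set (emitted v)) `|T' e x| ^+ 2.
Proof.
rewrite normr_dotp P_sym PP P_sum dotp_sumr; apply: eq_bigr => e _.
by rewrite -T'_adj normr_dotp.
Qed.

(** The vector y = x - p x is killed by the vertex projection, whose squared norm on y is the sum of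
    the |s_f^* y|^2 over the emitted edges; so each term vanishes. *)
Lemma T'P e x : T' e (P (origin e) x) = T' e x.
Proof.
apply/esym/eqP; rewrite -subr_eq0 -linearB; apply/eqP.
set y := x - _; have : P (origin e) y = 0 by rewrite linearB /= PP subrr.
move=> /(congr1 (fun z => `|z| ^+ 2)); rewrite P_norm normr0 expr0n /= => /eqP.
rewrite psumr_eq0 => [/allP h|f _]; last exact: exprn_ge0.
by have := h e; rewrite in_emitted eqxx /= expf_eq0 normr_eq0 /= => /(_ isT)/eqP.
Qed.

Lemma PT e x : P (origin e) (T e x) = T e x.
Proof. by apply: dotp_ext => y; rewrite P_sym !T_adj T'P. Qed.

Lemma PT_neq v e x : v <> origin e -> P v (T e x) = 0.
Proof. by move=> ve; rewrite -PT P_orth. Qed.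

Lemma T'P_neq v e x : origin e <> v -> T' e (P v x) = 0.
Proof. by move=> ve; rewrite -T'P P_orth// linear0. Qed.

(** Orthogonality of ranges is not among the Cuntz-Krieger relations. For a common origin it follows
    from [P_norm]: |s_f x|^2 is the sum of all |s_e^* s_f x|^2, and the term of f already exhausts
    it. *)
Lemma T'T_neq e f x : e <> f -> T' e (T f x) = 0.
Proof.
move=> ef; have [oef|oef] := pselect (origin e = origin f); last first.
  by rewrite -T'P PT_neq ?linear0.
have fE : f \in (fset_set (emitted (origin f)) : seq (edge E)).
  by rewrite in_emitted.
have := P_norm (origin f) (T f x); rewrite (bigD1_seq f) ?fset_uniq//=.
rewrite PT T'T.
have -> : `|T f x| ^+ 2 = `|P (terminus f) x| ^+ 2.
  by rewrite !normr_dotp T_adj T'T P_sym PP.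
rewrite -[X in X = _]addr0 => /addrI/esym/eqP.
rewrite psumr_eq0 => [/allP h|g _]; last exact: exprn_ge0.
have := h e; rewrite in_emitted oef eqxx => /(_ isT).
have -> : e != f by apply/eqP.
by rewrite /= expf_eq0 normr_eq0 /= => /eqP.
Qed.

(** The operators s_m and, in [word'], s_m^*. For empty [m] both are the identity and not a vertex
    projection, which is why hypotheses [P w x = x] accompany them. *)
Definition word m x : H := foldr (fun e y => T e y) x m.
Definition word' m x : H := foldl (fun y e => T' e y) x m.

Lemma word_adj m x y : dotp (word m x) y = dotp x (word' m y).
Proof.
rewrite /word /word'; elim: m x y => [//|e m ih] x y /=.
by rewrite T_adj ih.
Qed.

Lemma word_linear m (c : R[i]) x y : word m (c *: x + y) = c *: word m x + word m y.
Proof. by elim: m => [//|e m ih] /=; rewrite ih linearP. Qed.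

Lemma word'_linear m (c : R[i]) x y :
  word' m (c *: x + y) = c *: word' m x + word' m y.
Proof.
by rewrite /word'; elim: m x y => [//|e m ih] x y /=; rewrite linearP ih.
Qed.

Lemma wordZ m (c : R[i]) x : word m (c *: x) = c *: word m x.
Proof. by elim: m => [//|e m ih] /=; rewrite ih linearZZ. Qed.

Lemma word0 m : word m 0 = 0.
Proof. by rewrite -{1}(scale0r (0 : H)) wordZ scale0r. Qed.

Lemma word'0 m : word' m 0 = 0.
Proof. by rewrite /word'; elim: m => [//|e m ih] /=; rewrite linear0. Qed.

Lemma word_cat m n x : word (m ++ n) x = word m (word n x).
Proof. exact: foldr_cat. Qed.

Lemma word'_cat m n x : word' (m ++ n) x = word' n (word' m x).
Proof. exact: foldl_cat. Qed.

(** Generation applies to the elements that preserve [M] together with their adjoints; asking for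
    both makes this set stable under [star]. *)
Lemma invariant_rep (M : set H) : closed_subspace M ->
  (forall v x, M x -> M (P v x)) -> (forall e x, M x -> M (T e x)) ->
  (forall e x, M x -> M (T' e x)) -> forall a x, M x -> M (pi a x).
Proof.
move=> [Mcl M0 Mlin] MP MT MT'.
suff : [set a | forall x, M x -> M (pi a x) /\ M (pi (star a) x)] = setT.
  by move=> /seteqP[_ h] a x Mx; have [] := h a I x Mx.
apply: (ga_generated hA) => [|v x Mx|e x Mx].
- split; first split.
  + apply: closed_forall => x; apply: closed_forall => Mx.
    apply: closedI.
      apply: (@closed_lipschitz_preimage _ A H (fun a => pi a x) `|x|) => // a b.
      by rewrite -repB// mulrC rep_norm_le.
    apply: (@closed_lipschitz_preimage _ A H (fun a => pi (star a) x) `|x|) => // a b.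
    by rewrite -repB// -starB mulrC -(star_norm (a - b)) rep_norm_le.
  + by move=> x _; rewrite star0 !rep0.
  + move=> c a b Ma Mb x Mx; have [a1 a2] := Ma x Mx; have [b1 b2] := Mb x Mx.
    by rewrite star_antilinear !(rep_linear rep); split; exact: Mlin.
  + move=> a b Ma Mb x Mx; rewrite starM !(rep_mul rep).
    have [a1 a2] := Ma x Mx; have [b1 b2] := Mb x Mx.
    by have [? _] := Ma _ b1; have [_ ?] := Mb _ a2.
  + by move=> a Ma x Mx; rewrite starK; have [] := Ma x Mx.
- by have [_ ->] := ck_projection ck v; split; exact: MP.
- by split; [exact: MT|exact: MT'].
Qed.

(** The vectors z with <s_m s_n^* z, y> = 0 for all m, n form a closed subspace. It is invariant:
    s_e either cancels against the first letter of n or lengthens m, s_e^* lengthens n, and p_v is a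
    sum of s_e s_e^*. It is not the whole space, since empty words would give <y, y> = 0. *)
Lemma words_transitive x y : x <> 0 -> y <> 0 ->
  exists m n, dotp (word m (word' n x)) y <> 0.
Proof.
move=> x0 y0; apply: contrapT => hn.
pose M := [set z : H | forall m n, dotp (word m (word' n z)) y = 0].
have Mx : M x by move=> m n; apply: contrapT => h; apply: hn; exists m, n.
have Mcl : closed_subspace M.
  split.
  - apply: closed_forall => m; apply: closed_forall => n.
    move: (@dotp_closed _ _ (word n (word' m y))); congr (closed _).
    apply/seteqP; split => z /= h.
      by rewrite word_adj dotpC -word_adj dotpC h !rmorph0.
    by rewrite dotpC word_adj dotpC -word_adj h !rmorph0.
  - by move=> m n; rewrite word'0 word0 dotp0l.
  - move=> c z z' Mz Mz' m n; rewrite word'_linear word_linear dotpDl dotpZl.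
    by rewrite Mz Mz' mulr0 addr0.
have MT' e z : M z -> M (T' e z) by move=> Mz m n; have := Mz m (e :: n).
have MP v z : M z -> M (P v z).
  move=> Mz m [|e n] /=.
    rewrite P_sum; elim: (fset_set _ : seq _) => [|e l ih].
      by rewrite big_nil word0 dotp0l.
    rewrite big_cons -[T e _]scale1r word_linear dotpDl ih scale1r addr0.
    by have := Mz (rcons m e) [:: e]; rewrite -cats1 word_cat.
  have [->|ev] := pselect (v = origin e); first by rewrite T'P; have := Mz m (e :: n).
  by rewrite T'P_neq 1?word'0 ?word0 ?dotp0l//; apply/nesym.
have MT e z : M z -> M (T e z).
  move=> Mz m [|f n] /=.
    by have := Mz (rcons m e) [::]; rewrite -cats1 word_cat.
  have [->|ef] := pselect (f = e); first by rewrite T'T; exact: MP.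
  by rewrite T'T_neq// word'0 word0 dotp0l.
have [M0|M1] := irr.2 M Mcl (invariant_rep Mcl MP MT MT').
  by move: Mx; rewrite M0.
have My : M y by rewrite M1.
by apply: y0; apply: dotp_eq0; have := My [::] [::].
Qed.

Lemma word_walk v m x : P v (word m x) <> 0 ->
  exists2 w, walk v m w & P w x <> 0.
Proof.
elim: m v => [|e m ih] v /=; first by exists v.
have [->|ve] := pselect (v = origin e); last by rewrite PT_neq.
rewrite PT -TP eqxx /= => h; apply: ih => h0.
by apply: h; rewrite h0 linear0.
Qed.

Lemma word'_walk v m x : P v x = x -> word' m x <> 0 ->
  exists2 w, walk v m w & P w (word' m x) = word' m x.
Proof.
rewrite /word'; elim: m v x => [|e m ih] v x px /=; first by exists v.
have [->|ve] := pselect (v = origin e).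
  by rewrite eqxx /=; apply: ih; rewrite PT'.
by rewrite -px T'P_neq ?word'0; [move=> []|exact/nesym]; have := word'0 m.
Qed.

Definition live v := exists x, P v x <> 0.

(** On the empty walk the composite is the identity, so its value is [x] instead of [P w x]; this
    accounts for the second alternative. *)
Lemma word'_word v m w x : walk v m w -> word' m (word m x) = P w x \/ m = [::].
Proof.
rewrite /word /word'; elim: m v w x => [|e m ih] v w x /=; first by right.
move=> /andP[_ ew]; left; rewrite T'T.
case: m ih ew => [_ /eqP <- //|f m ih].
move=> /= /andP[/eqP fe fw]; rewrite -fe PT T'T.
have := ih (terminus e) w x; rewrite /= fe eqxx T'T => /(_ fw) [//|//].
Qed.

Lemma word'_word_P v m w x : walk v m w -> P w x = x -> word' m (word m x) = x.
Proof. by move=> mw wx; have [->//|->] := word'_word x mw. Qed.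

Lemma word_P v m w x : walk v m w -> P w x = x -> P v (word m x) = word m x.
Proof.
rewrite /word; case: m => [/eqP -> //|e m] /= /andP[/eqP <- _] _.
exact: PT.
Qed.

(** If s_e^* x vanished for every edge e emitted by v, then [P_norm] would give p_v x = 0. *)
Lemma live_next v : live v -> exists2 e, origin e = v & live (terminus e).
Proof.
move=> [x vx]; apply: contrapT => hn; apply: vx.
apply/eqP; rewrite -normr_eq0 -sqrf_eq0 P_norm; apply/eqP.
apply: big1_seq => e /andP[_]; rewrite in_emitted => /eqP ev.
suff -> : T' e x = 0 by rewrite normr0 expr0n.
apply: contrapT => ex; apply: hn; exists e => //.
by exists (T' e x); rewrite PT'.
Qed.

(** A nonzero coefficient forces both words to follow walks, and these end at one vertex because
    distinct vertex projections are orthogonal. *)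
Lemma walks_transitive u v x y : P u x = x -> P v y = y -> x <> 0 -> y <> 0 ->
  exists m n w, [/\ walk u n w, walk v m w, live w
    & dotp (word m (word' n x)) y <> 0].
Proof.
move=> ux vy x0 y0; have [m [n h]] := words_transitive x0 y0.
have h0 : word' n x <> 0 by move=> h0; apply: h; rewrite h0 word0 dotp0l.
have [w un wn] := word'_walk ux h0.
have [|w' vm w'n] := @word_walk v m (word' n x).
  by move=> hv; apply: h; rewrite -vy -P_sym hv dotp0l.
have ww' : w' = w by apply: contrapT => ww'; apply: w'n; rewrite -wn P_orth.
by exists m, n, w; split => //; [rewrite -ww'|exists (word' n x); rewrite wn].
Qed.

Lemma live_meet u v : live u -> live v ->
  exists m n w, [/\ walk u m w, walk v n w & live w].
Proof.
move=> [x ux] [y vy].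
have [m [n [w [un vm lw _]]]] := walks_transitive (PP u x) (PP v y) ux vy.
by exists n, m, w.
Qed.

Definition unary w := live w /\ forall m n u u', walk w m u -> walk w n u' ->
  live u -> live u' -> size m = size n -> m = n.

(** If no live vertex is unary, each has two different walks of equal length to live vertices, and
    [live_meet] prolongs them to a common end. Equal length guarantees an index at which they
    differ, as [branching_not_M] requires. *)
Lemma exists_unary v : condition_M E -> live v -> exists w, unary w.
Proof.
move=> M lv; apply: contrapT => hn.
have [e0 _ _] := live_next lv.
apply: (@branching_not_M E live e0 v lv) M => w lw.
have : ~ unary w by move=> uw; apply: hn; exists w.
move=> /not_andP[//|].
move=> /existsNP[m] /existsNP[n] /existsNP[u] /existsNP[u'].
move=> /not_implyP[wm] /not_implyP[wn] /not_implyP[lu] /not_implyP[lu'].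
move=> /not_implyP[smn mn].
have [m' [n' [w' [um un lw']]]] := live_meet lu lu'.
exists (m ++ m'), (n ++ n'), w'; split => //.
- by apply/walk_cat; exists u.
- by apply/walk_cat; exists u'.
have [k km kmn] : exists2 k, (k < size m)%N & nth e0 m k <> nth e0 n k.
  apply: contrapT => hk; apply: mn; apply: (@eq_from_nth _ e0 _ _ smn) => k km.
  by apply: contrapT => ?; apply: hk; exists k.
by exists k; rewrite !size_cat !ltn_addr -?smn// !nth_cat -smn km.
Qed.

Lemma word'Z m (c : R[i]) x : word' m (c *: x) = c *: word' m x.
Proof. by have := word'_linear m c x 0; rewrite word'0 !addr0. Qed.

Lemma word'_P v m w x : walk v m w -> P v x = x ->
  P w (word' m x) = word' m x.
Proof.
move=> vmw vx; have [->|/eqP h] := eqVneq (word' m x) 0; first by rewrite linear0.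
have [w' vmw' w'x] := word'_walk vx h.
by rewrite (walk_inj vmw vmw').
Qed.

(** Cancelling common first letters leads either to two distinct edges, whose ranges are orthogonal,
    or to consecutive letters that do not compose; both give 0. *)
Lemma word_orth m n x : size m = size n -> m <> n -> word' m (word n x) = 0.
Proof.
rewrite /word /word'; elim: m n => [|e m ih] [|f n] //= [smn] mn.
have [ef|ef] := pselect (e = f); last by rewrite T'T_neq//; have := word'0 m.
rewrite -ef T'T; case: n smn mn => [|g n] smn mn.
  by case: mn; rewrite ef (size0nil smn).
rewrite /=; have [<-|ge] := pselect (origin g = terminus e).
  by rewrite PT; apply: (ih (g :: n)) => // mgn; apply: mn; rewrite mgn ef.
by rewrite PT_neq; [have := word'0 m|exact/nesym].
Qed.

Lemma unary_path w : unary w -> exists q : nat -> edge E,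
  [/\ infinite_paths q, path_origin q = w
    & forall k, live (path_origin (pshift k q))].
Proof.
move=> [lw _]; pose LT := {v | live v}.
have /choice[next nextP] : forall v : LT, exists eu : edge E * LT,
    origin eu.1 = sval v /\ terminus eu.1 = sval eu.2.
  by move=> [v lv]; have [e ev le] := live_next lv; exists (e, exist _ _ le).
pose vs i := iter i (fun v : LT => (next v).2) (exist live w lw).
have qv i : origin (next (vs i)).1 = sval (vs i) by have [] := nextP (vs i).
exists (fun i => (next (vs i)).1); split => [i||k].
- by rewrite qv; have [_ ->] := nextP (vs i).
- by rewrite /path_origin qv.
- by rewrite /path_origin /pshift qv; exact: svalP.
Qed.

(** * A unary vertex, its path, and the vectors transported from it *)

Section Unary.
Variables (w : vertex E) (q : nat -> edge E).
Hypothesis uw : unary w.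
Hypothesis qp : infinite_paths q.
Hypothesis qw : path_origin q = w.
Hypothesis ql : forall k, live (path_origin (pshift k q)).
Local Notation vtx k := (path_origin (pshift k q)).

Lemma walk_q k : walk w (mkseq q k) (vtx k).
Proof. by rewrite -qw; exact: walk_mkseq. Qed.

Lemma unary_walk m u : walk w m u -> live u ->
  m = mkseq q (size m) /\ u = vtx (size m).
Proof.
move=> wm lu; have mq : m = mkseq q (size m).
  apply: (uw.2 _ _ _ _ wm (walk_q _) lu (ql _)).
  by rewrite size_mkseq.
by split => //; apply: walk_inj wm _; rewrite {1}mq; exact: walk_q.
Qed.

Lemma unary_walk_vtx k m u : walk (vtx k) m u -> live u ->
  m = mkseq (pshift k q) (size m).
Proof.
move=> km lu; have wkm : walk w (mkseq q k ++ m) u.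
  by apply/walk_cat; exists (vtx k) => //; exact: walk_q.
have [+ _] := unary_walk wkm lu.
rewrite size_cat size_mkseq mkseq_pshift_add => /eqP.
by rewrite eqseq_cat// eqxx => /eqP.
Qed.

Lemma walk_shift_q k l : walk (vtx k) (mkseq (pshift k q) l) (vtx (k + l)).
Proof.
have := walk_mkseq l (pshift_infinite k qp).
by rewrite /path_origin /pshift !addn0.
Qed.

(** The tail from [k] also starts at [vtx l], from where only one walk of each length leads to a
    live vertex. A path that returns to a vertex is therefore periodic from there on. *)
Lemma unary_shift_eq k l : vtx k = vtx l -> pshift k q = pshift l q.
Proof.
move=> kl; apply/funext => i; have h := walk_shift_q k i.+1.
rewrite kl in h; have := unary_walk_vtx h (ql _).
rewrite size_mkseq => /(congr1 (fun m => nth (q 0%N) m i)).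
by rewrite !nth_mkseq.
Qed.

(** Among the edges emitted by [vtx k] only [q k] has a live end, so the sum of the s_e s_e^* that
    equals p on this corner has a single nonzero term. *)
Lemma unary_step k x : P (vtx k) x = x -> T (q k) (T' (q k) x) = x.
Proof.
have ok : origin (q k) = vtx k by rewrite /path_origin /pshift addn0.
move=> kx; rewrite -[RHS]kx P_sum (bigD1_seq (q k)) ?fset_uniq ?in_emitted ?ok//=.
rewrite big1_seq ?addr0// => e /andP[ek]; rewrite in_emitted => /eqP oe.
suff -> : T' e x = 0 by rewrite linear0.
apply: contrapT => ex; move/eqP: ek; apply.
have le : live (terminus e) by exists (T' e x); rewrite PT'.
have := @unary_walk_vtx k [:: e] (terminus e); rewrite /= oe !eqxx.
by move=> /(_ isT le)[]; rewrite /pshift addn0.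
Qed.

Lemma unary_range k l x : P (vtx k) x = x ->
  word (mkseq (pshift k q) l) (word' (mkseq (pshift k q) l) x) = x.
Proof.
elim: l k x => [//|l ih] k x kx.
have -> : mkseq (pshift k q) l.+1 = q k :: mkseq (pshift k.+1 q) l.
  rewrite mkseq_cons /pshift addn0; congr (_ :: _); apply: eq_mkseq => i.
  by rewrite addSnnS.
rewrite /=.
have h : P (vtx k.+1) (T' (q k) x) = T' (q k) x.
  by have := qp k; rewrite /path_origin /pshift addn0 => <-; rewrite PT'.
by have := ih k.+1 _ h; rewrite /word /word' /= => ->; exact: unary_step.
Qed.

Definition qrot k l x := word (mkseq q k) (word' (mkseq q l) x).

Lemma rot_P k l x : vtx k = vtx l -> P w x = x -> P w (qrot k l x) = qrot k l x.
Proof.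
move=> kl wx; apply: (word_P (walk_q k)).
by rewrite kl; exact: word'_P (walk_q l) wx.
Qed.

Lemma rot_shift k l i x : vtx k = vtx l -> P w x = x ->
  qrot (k + i) (l + i) x = qrot k l x.
Proof.
move=> kl wx; rewrite /qrot !mkseq_pshift_add word_cat word'_cat.
rewrite (unary_shift_eq kl) unary_range//.
exact: word'_P (walk_q l) wx.
Qed.

Lemma vtx_add k l i : vtx k = vtx l -> vtx (i + k) = vtx (i + l).
Proof.
move=> /unary_shift_eq/(congr1 (fun r => r i)).
by rewrite /pshift /path_origin !addn0 ![(i + _)%N]addnC => ->.
Qed.

(** By [rot_shift] both factors can be lengthened until the two inner words have length l + k' and
    cancel. The indices then add, and this is the source of commutativity. *)
Lemma rot_mul k l k' l' x : vtx k = vtx l -> vtx k' = vtx l' -> P w x = x ->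
  qrot k l (qrot k' l' x) = qrot (k + k') (l + l') x.
Proof.
move=> kl kl' wx; rewrite -(rot_shift k' kl) ?rot_P//.
rewrite -(rot_shift l kl')// ![(_ + l)%N]addnC /qrot.
rewrite (word'_word_P (walk_q _))//.
by rewrite (vtx_add _ kl'); exact: word'_P (walk_q _) wx.
Qed.

Lemma rot_adj k l x y : dotp (qrot k l x) y = dotp x (qrot l k y).
Proof. by rewrite /qrot word_adj dotpC -word_adj -dotpC. Qed.

(** The set [V] for [schur_commutative]: elements of the corner of [p w], described through their
    action on its range only. *)
Definition rot_elements : set A := [set a | [/\ p w ** a = a, a ** p w = a
  & exists k l, vtx k = vtx l /\ forall x, P w x = x -> pi a x = qrot k l x]].

Lemma rot_element k l : vtx k = vtx l -> exists2 a, rot_elements a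
  & forall x, P w x = x -> pi a x = qrot k l x.
Proof.
move=> kl; have [pp _] := ck_projection ck w.
(* The seed [p w] provides an element even when both words are empty, since the algebra may have no
   unit; the compression by [p w] puts it in the corner. *)
pose b := foldr (fun e a => s e ** a)
  (foldl (fun a e => star (s e) ** a) (p w) (mkseq q l)) (mkseq q k).
have bE x : pi b x = word (mkseq q k) (word' (mkseq q l) (P w x)).
  rewrite /b /word /word'; elim: (mkseq q k) => [|e m ih] /=; last first.
    by rewrite (rep_mul rep) ih.
  elim: (mkseq q l) (p w) => [//|e m ih] a /=.
  by rewrite ih (rep_mul rep).
have aE x : P w x = x -> pi (p w ** b ** p w) x = qrot k l x.
  by move=> wx; rewrite !(rep_mul rep) wx bE wx rot_P.
exists (p w ** b ** p w) => //; split; last by exists k, l.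
  by rewrite !cmulA pp.
by rewrite -!cmulA pp.
Qed.

Lemma rot_scalar k l x : vtx k = vtx l -> P w x = x ->
  exists c : R[i], qrot k l x = c *: x.
Proof.
move=> kl wx; have [a aV aE] := rot_element kl; rewrite -aE//.
have pw := ck_projection ck w; have [pp sp] := pw.
apply: (schur_commutative rep pw _ _ _ aV wx).
- move=> b [pb bp [i [j [ij bE]]]]; split => //; split.
  + by rewrite -{1}sp -starM bp.
  + by rewrite -{1}sp -starM pb.
  + exists j, i; split=> // y wy; apply: dotp_ext => z.
    rewrite (rep_adj rep) -bp (rep_mul rep) bE ?PP//.
    by rewrite -rot_adj -P_sym rot_P.
- move=> y z wy wz y0 z0.
  (* Both walks run from [w] to the same live vertex, so they are initial segments of [q] and their
     word is one of the rotations. *)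
  have [m [n [u [wn wm lu h]]]] := walks_transitive wy wz y0 z0.
  have [mE um] := unary_walk wm lu; have [nE un] := unary_walk wn lu.
  have [|b bV bE] := @rot_element (size m) (size n); first by rewrite -um.
  by exists b => //; rewrite bE// /qrot -mE -nE.
- move=> b c y [_ _ [i [j [ij bE]]]] [_ _ [i' [j' [ij' cE]]]] wy.
  rewrite (cE y)// (bE y)// bE ?rot_P// cE ?rot_P// !rot_mul//.
  by rewrite [(i + _)%N]addnC [(j + _)%N]addnC.
Qed.

Variable xi : H.
Hypothesis wxi : P w xi = xi.
Hypothesis xi0 : xi <> 0.

(** The vector [xi] carried to the path [r], meaningful when [r] from position [k] on coincides with
    [q] from position [l] on. *)
Definition vec (r : nat -> edge E) k l := word (mkseq r k) (word' (mkseq q l) xi).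

Lemma vec_shift r k l i : pshift k r = pshift l q ->
  vec r (k + i) (l + i) = vec r k l.
Proof.
move=> kl; rewrite /vec !mkseq_pshift_add word_cat word'_cat kl unary_range//.
exact: word'_P (walk_q l) wxi.
Qed.

(** If [q] is eventually periodic, the tails of [r] and [q] can be aligned with different offsets.
    The two vectors then differ by a rotation applied to [xi], which is a scalar. *)
Lemma vec_scalar r k l k' l' : pshift k r = pshift l q -> pshift k' r = pshift l' q ->
  exists c : R[i], vec r k' l' = c *: vec r k l.
Proof.
move=> kl kl'; rewrite -(vec_shift k kl') -(vec_shift k' kl) addnC.
have e : vtx (l + k') = vtx (l' + k).
  congr path_origin; rewrite -!pshift_pshift -kl -kl' !pshift_pshift.
  by rewrite addnC.
have [c hc] := rot_scalar e wxi; exists c.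
rewrite /vec -wordZ -word'Z -hc /qrot (word'_word_P (walk_q _))//.
by rewrite e; exact: word'_P (walk_q _) wxi.
Qed.

Lemma vec_orth r r' k l k' l' : pshift k r = pshift l q ->
  pshift k' r' = pshift l' q -> r <> r' -> dotp (vec r k l) (vec r' k' l') = 0.
Proof.
move=> kl kl' rr'.
have [i ri] : exists i, r i <> r' i.
  by apply: contrapT => h; apply: rr'; apply/funext => i; apply: contrapT => ?; apply: h; exists i.
(* These shifts bring both words to the length k + k' + i + 1, which exceeds an index [i] where the
   paths differ. *)
rewrite -(vec_shift (k' + i.+1) kl) -(vec_shift (k + i.+1) kl') /vec.
rewrite word_adj word_orth ?dotp0r//.
  by rewrite !size_mkseq addnCA.
move=> /(congr1 (fun m => nth (q 0%N) m i)).
by rewrite !nth_mkseq// !addnA ltn_addl.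
Qed.

Lemma walk_vec r k l : infinite_paths r -> pshift k r = pshift l q ->
  walk (path_origin r) (mkseq r k) (vtx l).
Proof. by move=> rp <-; exact: walk_mkseq. Qed.

Lemma vec_neq0 r k l : infinite_paths r -> pshift k r = pshift l q ->
  vec r k l <> 0.
Proof.
move=> rp kl h; apply: xi0.
have h0 : P (vtx l) (word' (mkseq q l) xi) = word' (mkseq q l) xi.
  exact: word'_P (walk_q l) wxi.
have := word'_word_P (walk_vec rp kl) h0; rewrite -/(vec r k l) h word'0.
have := @unary_range 0 l xi; rewrite (_ : pshift 0 q = q)// qw => /(_ wxi) + e.
by rewrite -e word0.
Qed.

Lemma vec_P r k l : infinite_paths r -> pshift k r = pshift l q ->
  P (path_origin r) (vec r k l) = vec r k l.
Proof.
move=> rp kl; apply: (word_P (walk_vec rp kl)).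
exact: word'_P (walk_q l) wxi.
Qed.

(** A word pairing [xi] with [y] consists of an initial segment of [q] and a walk m from [v] to its
    end; the path sought is m followed by the remainder of [q]. *)
Lemma vec_total v y : P v y = y -> y <> 0 -> exists r k l,
  [/\ (path_class q `&` [set r | path_origin r = v]) r,
      pshift k r = pshift l q & dotp (vec r k l) y <> 0].
Proof.
move=> vy y0; have [m [n [u [wn vm lu h]]]] := walks_transitive wxi vy xi0 y0.
have [nE un] := unary_walk wn lu.
exists (concat m (pshift (size n) q)), (size m), (size n); split.
- split; last by apply: concat_origin vm _; rewrite un.
  split; last exact: tail_equiv_concat.
  by apply: concat_infinite vm _ _; rewrite ?un//; exact: pshift_infinite.
- by apply/funext => i; rewrite {1}/pshift concat_pshift.
- rewrite /vec -nE (_ : mkseq _ _ = m)//.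
  apply: (@eq_from_nth _ (q 0%N)); rewrite size_mkseq// => i im.
  by rewrite nth_mkseq// /concat im; apply: set_nth_default.
Qed.

(** The remainder after projecting on the orthogonal family lies in p_v H and is orthogonal to every
    transported vector, so [vec_total] leaves it no choice but 0. *)
Lemma P_finite_rank v :
  finite_set (path_class q `&` [set r | path_origin r = v]) ->
  exists l : seq H, forall x,
    P v x = \sum_(u <- l) (dotp x u / dotp u u) *: u.
Proof.
set F := _ `&` _ => finF.
(* One alignment is fixed for each path; [vec_scalar] shows that any other yields a multiple of the
   same vector. *)
have /choice[kl klP] : forall r, exists kl : nat * nat,
    tail_equiv q r -> pshift kl.1 r = pshift kl.2 q.
  move=> r; have [[l [k h]]|h] := pselect (tail_equiv q r); last by exists (0, 0)%N.
  by exists (k, l) => _; apply/funext => i; rewrite /pshift h.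
pose ur r := vec r (kl r).1 (kl r).2.
have FP r : r \in fset_set F -> F r by rewrite in_fset_set// inE.
exists [seq ur r | r <- fset_set F] => x; apply/eqP; rewrite -subr_eq0; apply/eqP.
rewrite big_map; set y := _ - _.
have vu r : F r -> P v (ur r) = ur r.
  by move=> [[rp qr] <-]; apply: vec_P => //; exact: klP.
have vy : P v y = y.
  rewrite /y linearB PP; congr (_ - _); rewrite linear_sum; apply: eq_big_seq => r rF.
  by rewrite linearZZ vu//; exact: FP.
have yu r : r \in fset_set F -> dotp y (ur r) = 0.
  move=> rF; have [[rp qr] rv] := FP r rF.
  rewrite /y dotpBl P_sym vu; last exact: FP.
  rewrite dotp_suml (bigD1_seq r) ?fset_uniq//= dotpZl divfK; last first.
    by apply/eqP => /dotp_eq0; apply: vec_neq0 => //; exact: klP.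
  rewrite big1_seq ?addr0 ?subrr// => r' /andP[r'r r'F].
  have [[r'p qr'] r'v] := FP r' r'F.
  rewrite dotpZl (vec_orth (klP r' qr') (klP r qr)) ?mulr0//.
  exact/eqP.
apply: contrapT => y0; have [r [k [l [rF rkl]]]] := vec_total vy y0; apply.
have [[rp qr] rv] := rF.
have [c ->] := vec_scalar (klP r qr) rkl.
by rewrite dotpZl dotpC yu ?rmorph0 ?mulr0// in_fset_set// inE.
Qed.

End Unary.
End GraphOperators.

(** * Total boundedness and compact operators *)

Section TotallyBounded.
Variable R : realType.

Definition totally_bounded (V : normedModType R[i]) (S : set V) :=
  forall e : R[i], 0 < e -> exists l : seq V,
    forall x, S x -> exists2 y, y \in l & `|x - y| <= e.

Lemma ultra_seq (T : eqType) (U : Type) (F : set_system U) (P : T -> set U)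
    (l : seq T) : UltraFilter F ->
  F [set x | exists2 y, y \in l & P y x] -> exists2 y, y \in l & F (P y).
Proof.
move=> FU; elim: l => [|y l ih] h.
  have [x [y]] := @filter_ex _ F _ _ h.
  by rewrite in_nil.
have [Py|nPy] := in_ultra_setVsetC (P y) FU.
  by exists y => //; rewrite inE eqxx.
have [|z zl Fz] := ih; last by exists z => //; rewrite inE zl orbT.
apply: filterS (filterI h nPy) => x [[z]]; rewrite inE => /orP[/eqP ->|zl] Pz Py //.
by exists z.
Qed.

(** An ultrafilter on the closure picks one ball of each finite net, hence is Cauchy. The net has
    radius e/2 because passing from the closure to [S] costs another e/2. *)
Lemma totally_bounded_precompact (V : completeNormedModType R[i]) (S : set V) :
  totally_bounded S -> precompact S.
Proof.
move=> Stb; rewrite precompactE compact_ultra => F FU FS.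
have FC : cauchy F.
  apply: cauchy_exP => e e0.
  have e2 : 0 < e / 2 by rewrite divr_gt0.
  have [l hl] := Stb _ e2.
  have [|y yl Fy] := @ultra_seq V V F (fun y => ball y e) l FU; last by exists y.
  apply: filterS FS => x /(_ _ (nbhsx_ballx x _ e2))[x' [Sx']].
  rewrite -ball_normE /= => xx'; have [y yl x'y] := hl x' Sx'.
  exists y => //; rewrite distrC -(subrKA x').
  rewrite (le_lt_trans (ler_normD _ _))//.
  by rewrite (splitr e) ltr_leD.
have Fp : cvg F by exact: cauchy_cvg.
exists (lim F); split => //; apply: (@closed_closure _ S) => U Up.
have FUS : F (closure S `&` U) by apply: filterI => //; exact: Fp.
by have [x [? ?]] := @filter_ex _ F _ _ FUS; exists x.
Qed.

Lemma precompact_totally_bounded (V : normedModType R[i]) (S : set V) :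
  precompact S -> totally_bounded S.
Proof.
rewrite precompactE compact_cover => Sc e e0.
have [||D _ SD] := Sc V setT (fun y => ball y e).
- by move=> y _; exact: ball_open.
- by move=> x _; exists x => //; exact: ballxx.
exists (D : seq V) => x Sx; have [y yD] := SD x (subset_closure Sx).
by rewrite -ball_normE /= => h; exists y => //; rewrite distrC ltW.
Qed.

Lemma totally_bounded_lipschitz (V W : normedModType R[i]) (f : V -> W)
    (C : R[i]) (S : set V) : 0 <= C ->
  (forall x y, `|f x - f y| <= C * `|x - y|) ->
  totally_bounded S -> totally_bounded (f @` S).
Proof.
move=> C0 fC Stb e e0; have C1 : 0 < C + 1 by rewrite ltr_wpDl.
have [l hl] := Stb (e / (C + 1)) (divr_gt0 e0 C1).
exists (map f l) => _ [x Sx <-]; have [y yl xy] := hl x Sx.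
exists (f y); first exact: map_f.
rewrite (le_trans (fC x y))// (@le_trans _ _ ((C + 1) * `|x - y|))//.
  by rewrite ler_wpM2r// lerDl.
by rewrite mulrC -ler_pdivlMr.
Qed.

Lemma totally_bounded_approx (V : normedModType R[i]) (S : set V) :
  (forall e : R[i], 0 < e -> exists2 S', totally_bounded S' &
     forall x, S x -> exists2 y, S' y & `|x - y| <= e) ->
  totally_bounded S.
Proof.
move=> h e e0; have e2 : 0 < e / 2 by rewrite divr_gt0.
have [S' S'tb SS'] := h _ e2; have [l hl] := S'tb _ e2.
exists l => x /SS'[y /hl[z zl yz] xy]; exists z => //.
by rewrite -(subrKA y) (le_trans (ler_normD _ _))// (splitr e) lerD.
Qed.

Lemma totally_bounded_sub (V : normedModType R[i]) (S S' : set V) :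
  S `<=` S' -> totally_bounded S' -> totally_bounded S.
Proof.
by move=> SS' S'tb e /S'tb[l hl]; exists l => x /SS'/hl.
Qed.

Lemma totally_boundedD (V : normedModType R[i]) (S S' : set V) :
  totally_bounded S -> totally_bounded S' ->
  totally_bounded [set z | exists x y, [/\ S x, S' y & z = x + y]].
Proof.
move=> Stb S'tb e e0; have e2 : 0 < e / 2 by rewrite divr_gt0.
have [l hl] := Stb _ e2; have [l' hl'] := S'tb _ e2.
exists [seq x + y | x <- l, y <- l'] => _ [x [y [/hl[x' xl xx'] /hl'[y' yl yy'] ->]]].
exists (x' + y'); first by apply/allpairsP; exists (x', y').
by rewrite opprD addrACA (le_trans (ler_normD _ _))// (splitr e) lerD.
Qed.

Lemma normc_real (a : R) : `|a%:C| = `|a|%:C.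
Proof. by rewrite normc_def /= expr0n addr0 sqrtr_sqr. Qed.

Lemma totally_bounded_disc (r : R[i]) :
  totally_bounded [set c : R[i]^o | `|c| <= r].
Proof.
move=> e0 /complex_gt0P[e' e'0 ->] {e0}.
(* The order of [R[i]] is partial: unless [0 <= r], the disc is empty. *)
have [r0|] := boolP (0 <= r); last first.
  move=> nr; exists [::] => x /= xr; exfalso; move: nr.
  by rewrite (le_trans _ xr).
have [b b0 ->] := complex_ge0P r0; move=> {r r0}.
pose e := e' / 2; have e0 : 0 < e by rewrite divr_gt0.
have [N NE] : exists N, N = (Num.truncn ((b + b) / e)).+1 by eexists.
pose g (k : nat) := k%:R * e - b.
have net (x : R) : `|x| <= b -> exists2 k, (k < N)%N & `|x - g k| <= e.
  rewrite ler_norml => /andP[bx xb].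
  have xb0 : 0 <= (x + b) / e by rewrite divr_ge0 ?(ltW e0)//; lra.
  exists (Num.truncn ((x + b) / e)).
    by rewrite NE ltnS le_truncn// ler_pM2r ?invr_gt0// lerD2r.
  have /andP[h1 h2] := truncn_itv xb0.
  rewrite ler_pdivlMr// in h1; rewrite ltr_pdivrMr// -natr1 mulrDl mul1r in h2.
  by rewrite /g ler_norml; apply/andP; split; lra.
exists [seq (g k +i* g l : R[i]^o) | k <- iota 0 N, l <- iota 0 N].
move=> [x y] /= xyb.
have [k kN xk] : exists2 k, (k < N)%N & `|x - g k| <= e.
  apply: net; rewrite -lecR (le_trans _ xyb)//.
  exact: (normc_ge_Re (x +i* y)).
have [l lN yl] : exists2 k, (k < N)%N & `|y - g k| <= e.
  apply: net; rewrite -lecR (le_trans _ xyb)//.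
  have := normc_ge_Re ((x +i* y) * 'i%C).
  by rewrite ReiNIm normrN normrM complexiE normCi mulr1.
exists (g k +i* g l); first by apply/allpairsP; exists (k, l); rewrite !mem_iota.
have -> : (x +i* y) - (g k +i* g l) = (x - g k)%:C + 'i%C * (y - g l)%:C.
  by apply/eqP; rewrite eq_complex /=; apply/andP; split; apply/eqP; ring.
rewrite (le_trans (ler_normD _ _))// normrM complexiE normCi mul1r !normc_real.
by rewrite -rmorphD lecR (splitr e') lerD.
Qed.

End TotallyBounded.

(** * Elements represented by compact operators *)

Section CompactOperators.
Variables (R : realType) (A : cstarAlgType R) (H : hilbertType R).
Variable pi : A -> {linear H -> H}.
Hypothesis rep : is_representation pi.
Local Notation unit_ball := [set x : H | `|x| <= 1].

Definition rep_compact (a : A) := totally_bounded (pi a @` unit_ball).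

Lemma rep_compactM a b : rep_compact b -> rep_compact (a ** b).
Proof.
move=> bK; apply: totally_bounded_sub (_ : totally_bounded (pi a @` (pi b @` unit_ball))).
  by move=> _ [x x1 <-]; exists (pi b x); [exists x|rewrite (rep_mul rep)].
apply: (totally_bounded_lipschitz (C := `|a|)) => // x y.
by rewrite -linearB rep_norm_le.
Qed.

Lemma rep_compact_closed : closed [set a | rep_compact a].
Proof.
move=> a aK; apply: totally_bounded_approx => e e0.
have [b [/= bK ab]] := aK _ (nbhsx_ballx a e e0).
exists (pi b @` unit_ball) => // _ [x /= x1 <-].
exists (pi b x); first by exists x.
rewrite -repB// (le_trans (rep_norm_le rep _ _))// -[e]mulr1 ler_pM//.
by apply/ltW; move: ab; rewrite -ball_normE.
Qed.

Lemma rep_compactD c a b : rep_compact a -> rep_compact b ->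
  rep_compact (c *: a + b).
Proof.
move=> aK bK; apply: totally_bounded_sub (totally_boundedD
  (totally_bounded_lipschitz (f := fun x : H => c *: x) (C := `|c|) _ _ aK) bK) => //.
- move=> _ [x x1 <-]; exists (c *: pi a x), (pi b x).
  by split; [exists (pi a x) => //; exists x|exists x|rewrite (rep_linear rep)].
- by move=> x y; rewrite -scalerBr normrZ.
Qed.

Lemma rep_compact0 : rep_compact 0.
Proof.
move=> e e0; exists [:: 0] => _ [x x1 <-]; exists 0; first by rewrite inE.
by rewrite rep0// subr0 normr0 ltW.
Qed.

(** Compactness of the adjoint is imposed rather than derived, so the one-sided [rep_compactM]
    suffices for products and their adjoints. *)
Lemma rep_compact_subalgebra :
  cstar_subalgebra [set a | rep_compact a /\ rep_compact (star a)].
Proof.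
split; first split.
- apply: closedI; first exact: rep_compact_closed.
  apply: (@closed_lipschitz_preimage _ A A star 1) => [//|a b|].
    by rewrite mul1r -starB star_norm.
  exact: rep_compact_closed.
- by rewrite /= star0; split; exact: rep_compact0.
- move=> c a b [aK a'K] [bK b'K]; rewrite /= star_antilinear.
  by split; exact: rep_compactD.
- by move=> a b [aK a'K] [bK b'K]; rewrite /= starM; split; exact: rep_compactM.
- by move=> a [aK a'K]; rewrite /= starK.
Qed.

Lemma finite_rank_compact a (l : seq H) (f : H -> H -> R[i]) :
  (forall u, exists C, forall x, `|x| <= 1 -> `|f u x| <= C) ->
  (forall x, pi a x = \sum_(u <- l) f u x *: u) -> rep_compact a.
Proof.
move=> fC aE; apply: totally_bounded_sub
  (_ : totally_bounded ((fun x => \sum_(u <- l) f u x *: u) @` unit_ball)).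
  by move=> _ [x x1 <-]; exists x => //; rewrite aE.
elim: l {aE} => [|u l ih].
  move=> e e0; exists [:: 0] => _ [x _ <-]; exists 0; first by rewrite inE.
  by rewrite big_nil subr0 normr0 ltW.
have [C uC] := fC u.
have uK : totally_bounded ((fun c : R[i]^o => c *: u) @` [set c : R[i]^o | `|c| <= C]).
  apply: (totally_bounded_lipschitz (C := `|u|)) (@totally_bounded_disc R C) => // x y.
  by rewrite -scalerBl normrZ mulrC.
apply: totally_bounded_sub (totally_boundedD uK ih) => _ [x x1 <-].
exists (f u x *: u), (\sum_(v <- l) f v x *: v); split; rewrite ?big_cons//.
  by exists (f u x) => //; exact: uC.
by exists x.
Qed.

End CompactOperators.

Lemma condition_M_liminal (R : realType) (E : digraph) (hrow : row_finite E)
    (A : cstarAlgType R) (p : vertex E -> A) (s : edge E -> A)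
    (hA : is_graph_algebra p s) : condition_M E -> liminal A.
Proof.
move=> M H pi rep irr a; apply: totally_bounded_precompact.
have ck := ga_cuntz_krieger hA.
have pK v : rep_compact pi (p v).
  have [[x vx]|nlv] := pselect (live p pi v); last first.
    apply: (@finite_rank_compact R A H pi (p v) [::] (fun _ _ => 0)).
      by move=> _; exists 0 => x _; rewrite normr0.
    move=> x; rewrite big_nil; apply: contrapT => vx; apply: nlv; by exists x.
  have [w uw] := exists_unary hrow hA rep irr M (ex_intro _ x vx).
  have [q [qp qw ql]] := unary_path hrow hA rep uw.
  have [y wy] := uw.1.
  have [l lE] := P_finite_rank hrow hA rep irr uw qp qw ql (PP hA rep w y) wy (M v q qp).
  apply: finite_rank_compact lE => u; exists (`|u| / `|dotp u u|) => z z1.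
  rewrite normrM normfV ler_wpM2r ?invr_ge0// (le_trans (dotp_norm_le _ _))//.
  by rewrite ler_piMl.
have /seteqP[_ /(_ a I)[//]] :
    [set b | rep_compact pi b /\ rep_compact pi (star b)] = setT.
apply: (ga_generated hA) => [|v|e]; first exact: rep_compact_subalgebra.
  by split; [|have [_ ->] := ck_projection ck v]; exact: pK.
(* It remains to treat the edges: s_e acts as s_e p_t(e) and s_e^* as s_e^* p_o(e), products whose
   right factor is already compact. *)
have extK b c : (forall x, pi b x = pi c x) -> rep_compact pi c -> rep_compact pi b.
  by move=> bc; apply: totally_bounded_sub => _ [x x1 <-]; exists x.
split.
  apply: extK (rep_compactM rep (s e) (pK (terminus e))) => x.
  by rewrite (rep_mul rep) (TP hA rep).
apply: extK (rep_compactM rep (star (s e)) (pK (origin e))) => x.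
by rewrite (rep_mul rep) (T'P hrow hA rep).
Qed.

(** * Bounded operators *)

Section BoundedOperators.
Variables (R : realType) (H : hilbertType R).
Implicit Types (x y z : H) (c : R[i]).

Definition adjoint_pair (T S : H -> H) := forall x y, dotp (T x) y = dotp x (S y).

(** Existence of an adjoint is demanded, which avoids the Riesz theorem; linearity is not demanded,
    since the adjoint relation implies it. *)
Definition bounded_adjointable : {pred H -> H} := fun T =>
  `[< (exists2 C : R[i], 0 <= C & forall x, `|T x| <= C * `|x|) /\
      exists S, adjoint_pair T S >].

Lemma bounded_adjointable_submod : submod_closed bounded_adjointable.
Proof.
split.
  apply/asboolP; split; first by exists 0 => // x; rewrite normr0 mul0r.
  by exists 0 => x y; rewrite dotp0l dotp0r.
move=> c T U /asboolP[[C C0 TC] [S TS]] /asboolP[[D D0 UD] [V UV]].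
apply/asboolP; split.
  exists (`|c| * C + D); first by rewrite addr_ge0// mulr_ge0.
  move=> x; rewrite (le_trans (ler_normD _ _))// mulrDl lerD//.
  by rewrite normrZ -mulrA ler_wpM2l.
exists (Num.conj c *: S + V) => x y.
by rewrite dotpDl dotpZl TS UV dotpDr dotpZr conjCK.
Qed.

HB.instance Definition _ :=
  GRing.isSubmodClosed.Build R[i] (H -> H) bounded_adjointable
    bounded_adjointable_submod.

Record bounded_op := BoundedOp {
  bounded_op_fun :> H -> H;
  bounded_opP : bounded_op_fun \in bounded_adjointable }.

HB.instance Definition _ := [isSub for bounded_op_fun].
HB.instance Definition _ := [Choice of bounded_op by <:].
HB.instance Definition _ := [SubChoice_isSubLmodule of bounded_op by <:].

Lemma bounded_op_bound (T : bounded_op) :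
  exists2 C : R[i], 0 <= C & forall x, `|T x| <= C * `|x|.
Proof. by have /asboolP[] := bounded_opP T. Qed.

Lemma bounded_op_adjoint (T : bounded_op) : exists S, adjoint_pair T S.
Proof. by have /asboolP[] := bounded_opP T. Qed.

Lemma adjoint_pairC (T S : H -> H) : adjoint_pair T S -> adjoint_pair S T.
Proof. by move=> TS x y; rewrite dotpC -TS -dotpC. Qed.

Lemma adjoint_pair_linear (T S : H -> H) : adjoint_pair T S -> linear T.
Proof.
move=> TS c x y; apply: dotp_ext => z.
by rewrite TS !dotpDl !dotpZl !TS.
Qed.

Lemma bounded_op_linear (T : bounded_op) : linear T.
Proof. by have [S] := bounded_op_adjoint T; exact: adjoint_pair_linear. Qed.

Lemma bounded_opE (T S : bounded_op) : T =1 S -> T = S.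
Proof. by move=> TS; apply/val_inj/funext. Qed.

Lemma bounded_op_lin (c : R[i]) (T S : bounded_op) x :
  (c *: T + S) x = c *: T x + S x.
Proof. by []. Qed.

Lemma bounded_opB (T S : bounded_op) x : (T - S) x = T x - S x.
Proof. by []. Qed.

(** The supremum is taken over real parts because norms have values in [R[i]]. *)
Definition opnorm (T : bounded_op) : R[i] :=
  (sup [set complex.Re `|T x| | x in [set x | `|x| <= 1]])%:C.

Lemma Re_norm (V : normedModType R[i]) (v : V) : (complex.Re `|v|)%:C = `|v|.
Proof. by rewrite RRe_real// normr_real. Qed.

Lemma opnorm_has_sup (T : bounded_op) :
  has_sup [set complex.Re `|T x| | x in [set x | `|x| <= 1]].
Proof.
have [C C0 TC] := bounded_op_bound T; have [r r0 CE] := complex_ge0P C0.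
split; first by exists (complex.Re `|T 0|), 0 => //=; rewrite normr0.
exists r => _ [x /= x1 <-]; rewrite -lecR Re_norm -CE (le_trans (TC x))//.
by rewrite ler_piMr.
Qed.

Lemma opnorm_ge0 (T : bounded_op) : 0 <= opnorm T.
Proof.
rewrite /opnorm ler0c; apply: le_trans (_ : complex.Re `|T 0| <= _).
  by rewrite -ler0c Re_norm.
apply: ub_le_sup; first exact: (opnorm_has_sup T).2.
by exists 0 => //=; rewrite normr0.
Qed.

Lemma opnormP (T : bounded_op) x : `|T x| <= opnorm T * `|x|.
Proof.
have T0 : T 0 = 0.
  have := bounded_op_linear T 1 0 0; rewrite !scale1r addr0 => e.
  by apply: (addrI (T 0)); rewrite addr0 -e.
have TZ c y : T (c *: y) = c *: T y.
  by have := bounded_op_linear T c y 0; rewrite T0 !addr0.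
have [->|x0] := eqVneq x 0; first by rewrite T0 !normr0 mulr0.
have x1 : 0 < `|x| by rewrite normr_gt0.
rewrite -ler_pdivrMr// mulrC.
have -> : `|x|^-1 * `|T x| = `|T (`|x|^-1 *: x)|.
  by rewrite TZ normrZ normfV normr_id.
rewrite -Re_norm /opnorm lecR; apply: ub_le_sup; first exact: (opnorm_has_sup T).2.
exists (`|x|^-1 *: x) => //=.
by rewrite normrZ normfV normr_id mulVf// normr_eq0.
Qed.

Lemma opnorm_le (T : bounded_op) C : 0 <= C ->
  (forall x, `|T x| <= C * `|x|) -> opnorm T <= C.
Proof.
move=> C0 TC; have [r r0 CE] := complex_ge0P C0.
rewrite CE /opnorm lecR; apply: ge_sup; first exact: (opnorm_has_sup T).1.
move=> _ [x /= x1 <-]; rewrite -lecR Re_norm -CE (le_trans (TC x))//.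
by rewrite ler_piMr.
Qed.

Lemma opnormD (T S : bounded_op) : opnorm (T + S) <= opnorm T + opnorm S.
Proof.
apply: opnorm_le => [|x]; first by rewrite addr_ge0 ?opnorm_ge0.
by rewrite (le_trans (ler_normD _ _))// mulrDl lerD ?opnormP.
Qed.

Lemma opnormZ c (T : bounded_op) : opnorm (c *: T) = `|c| * opnorm T.
Proof.
have le d (S : bounded_op) : opnorm (d *: S) <= `|d| * opnorm S.
  apply: opnorm_le => [|x]; first by rewrite mulr_ge0 ?opnorm_ge0.
  by rewrite normrZ -mulrA ler_wpM2l ?opnormP.
have [->|c0] := eqVneq c 0.
  apply/eqP; rewrite normr0 mul0r eq_le opnorm_ge0 andbT.
  by rewrite (le_trans (le _ _))// normr0 mul0r.
apply/eqP; rewrite eq_le le /=; have := le c^-1 (c *: T).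
by rewrite scalerA mulVf// scale1r normfV ler_pdivlMl// normr_gt0.
Qed.

Lemma opnorm_eq0 (T : bounded_op) : opnorm T = 0 -> T = 0.
Proof.
move=> T0; apply: bounded_opE => x; apply/eqP; rewrite -normr_le0.
by rewrite (le_trans (opnormP T x))// T0 mul0r.
Qed.

HB.instance Definition _ :=
  Lmodule_isNormed.Build R[i] bounded_op opnormD opnormZ opnorm_eq0.

Lemma bounded_op_norm (T : bounded_op) x : `|T x| <= `|T| * `|x|.
Proof. exact: opnormP. Qed.

Lemma bounded_op_norm_le (T : bounded_op) C : 0 <= C ->
  (forall x, `|T x| <= C * `|x|) -> `|T| <= C.
Proof. exact: opnorm_le. Qed.

Lemma adjoint_bounded (T : bounded_op) S : adjoint_pair T S ->
  forall x, `|S x| <= `|T| * `|x|.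
Proof.
move=> TS x; have [->|Sx0] := eqVneq (S x) 0; first by rewrite normr0 mulr_ge0.
have Sx : 0 < `|S x| by rewrite normr_gt0.
rewrite -(@ler_pM2r _ `|S x|)// -expr2.
have -> : `|S x| ^+ 2 = `|dotp (T (S x)) x|.
  by rewrite TS -normr_dotp normrX normr_id.
rewrite (le_trans (dotp_norm_le _ _))// mulrAC ler_wpM2r//.
exact: bounded_op_norm.
Qed.

Lemma star_op_subproof (T : bounded_op) : exists S : bounded_op, adjoint_pair T S.
Proof.
have [S TS] := bounded_op_adjoint T.
suff SP : S \in bounded_adjointable by exists (BoundedOp SP).
apply/asboolP; split; last by exists T; exact: adjoint_pairC.
by exists `|T| => //; exact: adjoint_bounded.
Qed.

Definition star_op (T : bounded_op) : bounded_op := sval (cid (star_op_subproof T)).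

Lemma star_opP (T : bounded_op) : adjoint_pair T (star_op T).
Proof. exact: svalP (cid (star_op_subproof T)). Qed.

Lemma star_op_uniq (T S : bounded_op) : adjoint_pair T S -> star_op T = S.
Proof.
move=> /adjoint_pairC TS; apply: bounded_opE => x; apply: dotp_ext => y.
by rewrite TS (adjoint_pairC (star_opP T)).
Qed.

Lemma comp_op_subproof (T S : bounded_op) : (T \o S) \in bounded_adjointable.
Proof.
apply/asboolP; split.
  exists (`|T| * `|S|); first by rewrite mulr_ge0.
  move=> x /=; rewrite (le_trans (bounded_op_norm _ _))// -mulrA ler_wpM2l//.
  exact: bounded_op_norm.
exists (star_op S \o star_op T) => x y /=.
by rewrite (star_opP T) (star_opP S).
Qed.

Definition comp_op (T S : bounded_op) : bounded_op := BoundedOp (comp_op_subproof T S).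

Lemma star_op_norm (T : bounded_op) : `|star_op T| <= `|T|.
Proof. exact: bounded_op_norm_le (adjoint_bounded (star_opP T)). Qed.

Lemma comp_op_norm (T S : bounded_op) : `|comp_op T S| <= `|T| * `|S|.
Proof.
apply: bounded_op_norm_le => [|x]; first by rewrite mulr_ge0.
by rewrite (le_trans (bounded_op_norm T (S x)))// -mulrA ler_wpM2l// bounded_op_norm.
Qed.

Lemma comp_star_op_norm (T : bounded_op) :
  `|comp_op (star_op T) T| = `|T| ^+ 2.
Proof.
apply/eqP; rewrite eq_le; apply/andP; split.
  rewrite (le_trans (comp_op_norm _ _))// expr2 ler_wpM2r//.
  exact: star_op_norm.
(* The reverse inequality comes from |T x|^2 = <T^* T x, x>, which makes sqrt c a bound for T. *)
set c := `|comp_op _ _|; have c0 : 0 <= c by exact: normr_ge0.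
rewrite -[c]sqrtCK ler_pXn2r ?nnegrE ?sqrtC_ge0//.
apply: bounded_op_norm_le => [|x]; first by rewrite sqrtC_ge0.
rewrite -(@ler_pXn2r _ 2) ?nnegrE ?mulr_ge0 ?sqrtC_ge0// exprMn sqrtCK.
have -> : `|T x| ^+ 2 = `|dotp (comp_op (star_op T) T x) x|.
  rewrite /= (adjoint_pairC (star_opP T)).
  by rewrite -normr_dotp normrX normr_id.
rewrite (le_trans (dotp_norm_le _ _))// expr2 mulrA ler_wpM2r//.
exact: bounded_op_norm.
Qed.

(** The pointwise limit must again have an adjoint, so the limits of T x and of T^* x are taken
    together; [star_op] is norm decreasing, hence the second family is Cauchy as well. *)
Lemma bounded_op_complete (F : set_system bounded_op) :
  ProperFilter F -> cauchy F -> cvg F.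
Proof.
move=> FF FC.
have {FC}/cauchy_ballP FC := FC.
have FCe (e : R[i]) : 0 < e -> exists T0, F (ball T0 e).
  by move=> e0; move/cauchy_ballP/cauchyP: FC; apply.
have ev_cauchy (f : bounded_op -> H) (C : R[i]) : 0 <= C ->
    (forall T S, `|f T - f S| <= C * `|T - S|) -> cvg (f T @[T --> F]).
  move=> C0 fC; apply: cauchy_cvg; apply: cauchy_exP => e e0.
  have C1 : 0 < C + 1 by rewrite ltr_wpDl.
  have [T0 FT0] := FCe _ (divr_gt0 e0 C1).
  exists (f T0).
  apply: (@filterS _ F _ (ball T0 (e / (C + 1))) (f @^-1` ball (f T0) e)) FT0 => T.
  rewrite /= -!ball_normE /= => h.
  rewrite (le_lt_trans (fC _ _))// (@le_lt_trans _ _ ((C + 1) * `|T0 - T|))//.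
    by rewrite ler_wpM2r// lerDl.
  by rewrite mulrC -ltr_pdivlMr.
have evB (T S : bounded_op) x : `|T x - S x| <= `|x| * `|T - S|.
  by rewrite -bounded_opB mulrC bounded_op_norm.
have starB (T S : bounded_op) : star_op T - star_op S = star_op (T - S).
  apply/esym/star_op_uniq => x y.
  by rewrite !bounded_opB dotpBl dotpBr !(star_opP).
have evsB (T S : bounded_op) x :
    `|star_op T x - star_op S x| <= `|x| * `|T - S|.
  rewrite (le_trans (evB _ _ _))// ler_wpM2l// starB; exact: star_op_norm.
pose ev x (T : bounded_op) : H := T x.
pose ev' x (T : bounded_op) : H := star_op T x.
pose L x := lim (ev x @ F); pose L' x := lim (ev' x @ F).
have LP x : ev x @ F --> L x.
  exact: (ev_cauchy (ev x) _ _ (fun T S => evB T S x)).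
have L'P x : ev' x @ F --> L' x.
  exact: (ev_cauchy (ev' x) _ _ (fun T S => evsB T S x)).
have LT0 T0 e x : 0 < e -> F (ball T0 e) -> `|T0 x - L x| <= e * `|x|.
  move=> e0 FT0; apply/ler_addgt0Pr => d d0.
  have /cvgrPdist_lt/(_ d d0) FL := LP x.
  have [T [/= h1 h2]] := filter_ex (filterI FT0 FL).
  rewrite -(subrKA (T x)) (le_trans (ler_normD _ _))// lerD//.
    rewrite (le_trans (evB _ _ _))// mulrC ler_wpM2r//.
    by apply/ltW; move: h1; rewrite -ball_normE.
  by rewrite distrC ltW.
have Ladj : adjoint_pair L L'.
  move=> x y; apply/eqP; rewrite -subr_eq0 -normr_eq0; apply/eqP.
  apply: (@ler0_small _ _ (`|x| + `|y|)) => // [|d d0]; first exact: addr_ge0.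
  have /cvgrPdist_lt/(_ d d0) FL := LP x.
  have /cvgrPdist_lt/(_ d d0) FL' := L'P y.
  have [T [/= h1 h2]] := filter_ex (filterI FL FL').
  have -> : dotp (L x) y - dotp x (L' y) =
     dotp (L x - T x) y - dotp x (L' y - star_op T y).
    by rewrite dotpBl dotpBr star_opP; ring.
  rewrite (le_trans (ler_normB _ _))// mulrDl addrC lerD//.
    by rewrite (le_trans (dotp_norm_le _ _))// ler_wpM2l// ltW.
  by rewrite (le_trans (dotp_norm_le _ _))// mulrC ler_wpM2l// ltW.
have LB : L \in bounded_adjointable.
  apply/asboolP; split; last by exists L'.
  have [T0 FT0] := FCe 1 ltr01.
  exists (`|T0| + 1); first by rewrite addr_ge0.
  move=> x; rewrite -(subrK (T0 x) (L x)) addrC (le_trans (ler_normD _ _))//.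
  by rewrite mulrDl lerD ?bounded_op_norm// distrC LT0.
apply/cvg_ex; exists (BoundedOp LB); apply/cvgrPdist_le => e e0.
have e2 : 0 < e / 2 by rewrite divr_gt0.
have [T0 FT0] := FCe _ e2.
apply: (filterS _ (FT0)) => T T0T.
rewrite -(subrKA T0) (le_trans (ler_normD _ _))// (splitr e) lerD//.
  rewrite distrC; apply: bounded_op_norm_le => [|x]; first exact: ltW.
  by rewrite bounded_opB; exact: LT0.
by apply/ltW; move: T0T; rewrite -ball_normE.
Qed.

HB.instance Definition _ := Uniform_isComplete.Build bounded_op bounded_op_complete.

Lemma comp_opA : associative comp_op.
Proof. by move=> T S U; exact: bounded_opE. Qed.

Lemma comp_op_linearl c (T S U : bounded_op) :
  comp_op (c *: T + S) U = c *: comp_op T U + comp_op S U.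
Proof. exact: bounded_opE. Qed.

Lemma comp_op_linearr c (T S U : bounded_op) :
  comp_op U (c *: T + S) = c *: comp_op U T + comp_op U S.
Proof. by apply: bounded_opE => x /=; exact: bounded_op_linear. Qed.

Lemma star_op_antilinear c (T S : bounded_op) :
  star_op (c *: T + S) = Num.conj c *: star_op T + star_op S.
Proof.
apply: star_op_uniq => x y.
by rewrite !bounded_op_lin dotpDl dotpZl dotpDr dotpZr conjCK !star_opP.
Qed.

Lemma star_opK : involutive star_op.
Proof. by move=> T; apply: star_op_uniq; apply: adjoint_pairC; exact: star_opP. Qed.

Lemma star_opM (T S : bounded_op) :
  star_op (comp_op T S) = comp_op (star_op S) (star_op T).
Proof. by apply: star_op_uniq => x y /=; rewrite !star_opP. Qed.

HB.instance Definition _ := isCStarAlgebra.Build R bounded_op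
  comp_opA comp_op_linearl comp_op_linearr star_op_antilinear star_opK star_opM
  comp_op_norm comp_star_op_norm.

End BoundedOperators.

(** * Unordered sums and square summable families *)

Section Sums.
Variables (R : realType) (X : choiceType).
Implicit Types (w u : X -> R[i]) (s M e : R[i]) (l : seq X).

(** Unordered summation: duplicate-free lists stand for finite subsets, and no enumeration of [X] is
    chosen. *)
Definition has_sum w s := forall e, 0 < e -> exists l, forall l',
  uniq l' -> {subset l <= l'} -> `|s - \sum_(x <- l') w x| <= e.

Definition bounded_sums u M := forall l, uniq l -> \sum_(x <- l) u x <= M.

Lemma has_sum_uniq w s s' : has_sum w s -> has_sum w s' -> s = s'.
Proof.
move=> ws ws'; apply/eqP; rewrite -subr_eq0 -normr_eq0; apply/eqP.
apply: (@ler0_small _ _ 2) => // e e0.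
have [l hl] := ws e e0; have [l' hl'] := ws' e e0.
have un := undup_uniq (l ++ l').
have sl : {subset l <= undup (l ++ l')}.
  by move=> x xl; rewrite mem_undup mem_cat xl.
have sl' : {subset l' <= undup (l ++ l')}.
  by move=> x xl; rewrite mem_undup mem_cat xl orbT.
rewrite -(subrKA (\sum_(x <- undup (l ++ l')) w x)) (le_trans (ler_normD _ _))//.
by rewrite mulr_natl mulr2n lerD ?hl// distrC hl'.
Qed.

Lemma has_sum_linear (c : R[i]) w w' s s' : has_sum w s -> has_sum w' s' ->
  has_sum (fun x => c * w x + w' x) (c * s + s').
Proof.
move=> ws ws' e e0; have c1 : 0 < `|c| + 1 by rewrite ltr_wpDl.
have e2 : 0 < e / 2 by rewrite divr_gt0.
have [l hl] := ws _ (divr_gt0 e2 c1); have [l' hl'] := ws' _ e2.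
exists (l ++ l') => k ku lk.
have sl : {subset l <= k} by move=> x xl; apply: lk; rewrite mem_cat xl.
have sl' : {subset l' <= k} by move=> x xl; apply: lk; rewrite mem_cat xl orbT.
rewrite big_split /= -mulr_sumr opprD addrACA -mulrBr.
rewrite (le_trans (ler_normD _ _))// (splitr e) lerD ?hl'// normrM.
rewrite (@le_trans _ _ ((`|c| + 1) * `|s - \sum_(x <- k) w x|))//.
  by rewrite ler_wpM2r// lerDl.
by rewrite mulrC -ler_pdivlMr// hl.
Qed.

Lemma has_sum_conj w s : has_sum w s ->
  has_sum (fun x => Num.conj (w x)) (Num.conj s).
Proof.
move=> ws e /ws[l hl]; exists l => l' ul' ll'.
by rewrite -rmorph_sum -rmorphB norm_conjC hl.
Qed.

Lemma ler_sum_subset u l l' : (forall x, 0 <= u x) -> uniq l -> uniq l' ->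
  {subset l <= l'} -> \sum_(x <- l) u x <= \sum_(x <- l') u x.
Proof.
move=> u0 ul ul' ll'; rewrite [leRHS](bigID (mem l)) /=.
have -> : \sum_(x <- l) u x = \sum_(x <- l' | x \in l) u x.
  rewrite -[RHS]big_filter; apply: perm_big; apply: uniq_perm => //.
    exact: filter_uniq.
  move=> x; rewrite mem_filter; case xl : (x \in l) => //=.
  by rewrite ll'.
by rewrite lerDl sumr_ge0.
Qed.

Lemma has_sum_nonneg u M : (forall x, 0 <= u x) -> bounded_sums u M ->
  exists s, [/\ has_sum u s, 0 <= s, s <= M & bounded_sums u s].
Proof.
move=> u0 uM.
have sum0 l : 0 <= \sum_(x <- l) u x by rewrite sumr_ge0.
have M0 : 0 <= M by have := uM [::] isT; rewrite big_nil.
have [m m0 ME] := complex_ge0P M0.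
have ReE l : (complex.Re (\sum_(x <- l) u x))%:C = \sum_(x <- l) u x.
  by rewrite RRe_real// ger0_real.
pose S := [set complex.Re (\sum_(x <- l) u x) | l in [set l | uniq l]].
have hS : has_sup S.
  split; first by exists (complex.Re (\sum_(x <- [::]) u x)), [::].
  by exists m => _ [l /= ul <-]; rewrite -lecR ReE -ME uM.
exists (sup S)%:C; split.
- move=> e /complex_gt0P[r r0 ->].
  have [_ [l /= ul <-] hl] := sup_adherent r0 hS.
  exists l => l' ul' ll'.
  have le' : complex.Re (\sum_(x <- l') u x) <= sup S.
    by apply: ub_le_sup hS.2 _ _; exists l'.
  rewrite -ReE -rmorphB normc_def /= expr0n addr0 sqrtr_sqr lecR ger0_norm ?subr_ge0//.
  rewrite lerBlDr -lerBlDl (le_trans (ltW hl))// -lecR !ReE.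
  exact: ler_sum_subset.
- rewrite ler0c (le_trans (_ : 0 <= complex.Re (\sum_(x <- [::]) u x)))//.
    by rewrite -ler0c ReE.
  by apply: ub_le_sup hS.2 _ _; exists [::].
- rewrite ME lecR; apply: ge_sup; first exact: hS.1.
  by move=> _ [l /= ul <-]; rewrite -lecR ReE -ME uM.
- move=> l ul; rewrite -ReE lecR; apply: ub_le_sup hS.2 _ _; by exists l.
Qed.

Lemma bounded_sums_le u u' (C : R[i]) M : 0 <= C -> (forall x, u x <= C * u' x) ->
  bounded_sums u' M -> bounded_sums u (C * M).
Proof.
move=> C0 uu' u'M l ul; rewrite (@le_trans _ _ (\sum_(x <- l) C * u' x))//.
  exact: ler_sum.
by rewrite -mulr_sumr ler_wpM2l// u'M.
Qed.

(** Real and imaginary parts h are treated separately, each as the difference of the nonnegative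
    families h + |h| and |h|. *)
Lemma has_sum_abs w M : bounded_sums (fun x => `|w x|) M ->
  exists s, has_sum w s.
Proof.
move=> wM.
have real_part (h : R[i] -> R) : (forall z, `|h z|%:C <= `|z|) ->
    exists s, has_sum (fun x => (h (w x))%:C) s.
  move=> hle.
  have [||s [hs _ _ _]] := @has_sum_nonneg (fun x => (h (w x) + `|h (w x)|)%:C) (2 * M).
  - by move=> x; rewrite ler0c; have := ler_norm (- h (w x)); rewrite normrN; lra.
  - apply: bounded_sums_le wM => // x.
    have -> : (h (w x) + `|h (w x)|)%:C = (h (w x))%:C + `|h (w x)|%:C.
      by rewrite rmorphD.
    rewrite mulr_natl mulr2n lerD ?hle// (le_trans _ (hle _))//.
    by rewrite lecR ler_norm.
  have [||s' [hs' _ _ _]] := @has_sum_nonneg (fun x => `|h (w x)|%:C) (1 * M).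
  - by move=> x; rewrite ler0c.
  - by apply: bounded_sums_le wM => // x; rewrite mul1r.
  exists (-1 * s' + s); have := has_sum_linear (-1) hs' hs.
  congr has_sum; apply/funext => x; rewrite mulN1r addrC -rmorphB addrK //.
have [s hs] := real_part (@complex.Re R) (@normc_ge_Re R).
have [|s' hs'] := real_part (@complex.Im R).
  move=> z; have := normc_ge_Re (z * 'i%C).
  by rewrite ReiNIm normrN normrM complexiE normCi mulr1.
exists ('i%C * s' + s); have := has_sum_linear 'i%C hs' hs.
by congr has_sum; apply/funext => x; rewrite addrC -complexE.
Qed.

Definition sumC w : R[i] := xget 0 [set s | has_sum w s].

Lemma sumCP w M : bounded_sums (fun x => `|w x|) M -> has_sum w (sumC w).
Proof. by move=> /has_sum_abs[s hs]; exact: (xgetPex 0 (ex_intro _ s hs)). Qed.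

Lemma sumCE w s : has_sum w s -> sumC w = s.
Proof.
move=> ws; apply: (has_sum_uniq _ ws).
exact: (xgetPex 0 (ex_intro _ s ws)).
Qed.

(* A partial injection of X: g x = Some y iff g' y = Some x. *)
Definition partial_inverse (g g' : X -> option X) :=
  forall x y, g x = Some y <-> g' y = Some x.

Definition pullback (g : X -> option X) w : X -> R[i] := fun x => oapp w 0 (g x).

Lemma partial_inverse_sym g g' : partial_inverse g g' -> partial_inverse g' g.
Proof. by move=> gg' x y; split => /gg'. Qed.

Lemma pmap_partial_uniq g g' l : partial_inverse g g' -> uniq l -> uniq (pmap g l).
Proof.
move=> gg'; elim: l => [//|x l ih] /= /andP[xl /ih ul].
case gx : (g x) => [y|] //=; rewrite ul andbT.
apply: contra xl; rewrite mem_pmap => /mapP[x' x'l] /esym/gg' hx.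
by move/gg': gx; rewrite hx => -[<-].
Qed.

Lemma sum_pullback g w l :
  \sum_(x <- l) pullback g w x = \sum_(y <- pmap g l) w y.
Proof.
elim: l => [|x l ih]; first by rewrite !big_nil.
by rewrite big_cons ih /pullback /=; case: (g x) => [y|] /=; rewrite ?big_cons ?add0r.
Qed.

Lemma has_sum_pullback g g' w s : partial_inverse g g' ->
  (forall y, g' y = None -> w y = 0) -> has_sum w s -> has_sum (pullback g w) s.
Proof.
move=> gg' w0 ws e e0; have [l hl] := ws e e0.
exists (pmap g' l) => l' ul' ll'; rewrite sum_pullback.
(* The indices of [l] outside the image of [g] are appended so that the list contains [l]; there [w]
   is 0 and the sum is unchanged. *)
pose m := pmap g l' ++ [seq y <- undup l | g' y == None].
have -> : \sum_(y <- pmap g l') w y = \sum_(y <- m) w y.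
  rewrite big_cat /= [X in _ + X]big1_seq ?addr0// => y /andP[_].
  by rewrite mem_filter => /andP[/eqP/w0].
apply: hl.
  rewrite cat_uniq (pmap_partial_uniq gg' ul') filter_uniq ?undup_uniq// andbT.
  apply/hasPn => y; rewrite mem_filter => /andP[/eqP gy _].
  rewrite mem_pmap; apply/mapP => -[x _ /esym/gg'].
  by rewrite gy.
move=> y yl; rewrite mem_cat mem_filter mem_undup yl andbT.
case gy : (g' y) => [x|]; last by rewrite orbT.
rewrite orbF mem_pmap; apply/mapP; exists x; last by apply/esym/gg'.
by apply: ll'; rewrite mem_pmap; apply/mapP; exists y.
Qed.

End Sums.

(** Proved for a bare dot product, as the triangle inequality of l^2 relies on it before any norm is
    available. *)
Lemma dot_CauchySchwarz (R : realType) (U : lmodType R[i])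
    (f : {dot U for (@Num.conj R[i])}) (u v : U) :
  `|f u v| ^+ 2 <= f u u * f v v.
Proof.
have fC x y : f x y = Num.conj (f y x) by rewrite hermC expr0 mul1r.
have f0 x : 0 <= f x x.
  have [->|x0] := eqVneq x 0; first by rewrite linear0l.
  by rewrite ltW// neq0_dnorm_gt0.
have [->|v0] := eqVneq v 0.
  by rewrite linear0r normr0 expr0n /= mulr_ge0.
have vv : 0 < f v v by rewrite neq0_dnorm_gt0.
pose a := f u v / f v v.
have avv : a * f v v = f u v by rewrite /a divfK ?gt_eqF.
have fB x : f (u - a *: v) x = f u x - a * f v x.
  by rewrite linearBl /= linearZl_LR.
have o : f (u - a *: v) v = 0 by rewrite fB avv subrr.
have := f0 (u - a *: v).
have -> : f (u - a *: v) (u - a *: v) = f u u - a * f v u.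
  rewrite [LHS]fC fB [f v _]fC o rmorph0 mulr0 subr0 -fC.
  exact: fB.
rewrite subr_ge0 -(ler_pM2r vv) mulrAC avv [f v u]fC.
by rewrite normCK.
Qed.

Section SquareSummable.
Variables (R : realType) (X : choiceType).
Local Notation C := (R[i]^o).
Implicit Types (f g : X -> C) (l : seq X).

Definition square_summable : {pred X -> C} := fun f =>
  `[< exists M : R[i], bounded_sums (fun x => `|f x| ^+ 2) M >].

Lemma square_summable_submod : submod_closed square_summable.
Proof.
split.
  apply/asboolP; exists 0 => l _; rewrite big1// => x _.
  by rewrite normr0 expr0n.
move=> c f g /asboolP[M fM] /asboolP[N gN]; apply/asboolP.
exists ((2 * `|c| ^+ 2) * M + 2 * N) => l ul.
rewrite (@le_trans _ _ (\sum_(x <- l) ((2 * `|c| ^+ 2) * `|f x| ^+ 2 + 2 * `|g x| ^+ 2)))//.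
  apply: ler_sum => x _.
  rewrite (@le_trans _ _ ((`|c * f x| + `|g x|) ^+ 2))//.
    by rewrite ler_pXn2r ?nnegrE ?addr_ge0// ler_normD.
  rewrite -mulrA -mulrDr -exprMn -normrM.
  have real2 (a b : R[i]) : 0 <= a -> 0 <= b -> (a + b) ^+ 2 <= 2 * (a ^+ 2 + b ^+ 2).
    move=> a0 b0; rewrite -subr_ge0.
    have -> : 2 * (a ^+ 2 + b ^+ 2) - (a + b) ^+ 2 = (a - b) ^+ 2 by ring.
    by rewrite real_exprn_even_ge0// rpredB// ger0_real.
  exact: real2.
rewrite big_split /= -!mulr_sumr lerD// ler_wpM2l ?fM ?gN//.
by rewrite mulr_ge0// exprn_ge0.
Qed.

HB.instance Definition _ :=
  GRing.isSubmodClosed.Build R[i] (X -> C) square_summable square_summable_submod.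

Record l2 := L2 { l2_fun :> X -> C; l2P : l2_fun \in square_summable }.

HB.instance Definition _ := [isSub for l2_fun].
HB.instance Definition _ := [Choice of l2 by <:].
HB.instance Definition _ := [SubChoice_isSubLmodule of l2 by <:].

Lemma l2_ext (f g : l2) : f =1 g -> f = g.
Proof. by move=> fg; apply/val_inj/funext. Qed.

Lemma l2_bounded (f : l2) : exists M : R[i], bounded_sums (fun x => `|f x| ^+ 2) M.
Proof. by have /asboolP := l2P f. Qed.

Definition l2_dot (f g : l2) : R[i] := sumC (fun x => f x * Num.conj (g x)).

Lemma l2_dotP (f g : l2) : has_sum (fun x => f x * Num.conj (g x)) (l2_dot f g).
Proof.
have [M fM] := l2_bounded f; have [N gN] := l2_bounded g.
apply: (@sumCP _ _ _ (M + N)) => l ul.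
rewrite (@le_trans _ _ (\sum_(x <- l) (`|f x| ^+ 2 + `|g x| ^+ 2)))//.
  apply: ler_sum => x _; rewrite normrM norm_conjC -subr_ge0.
  have -> : `|f x| ^+ 2 + `|g x| ^+ 2 - `|f x| * `|g x| =
     2^-1 * ((`|f x| - `|g x|) ^+ 2 + (`|f x| ^+ 2 + `|g x| ^+ 2)) by field.
  rewrite mulr_ge0 ?invr_ge0// addr_ge0//; last by rewrite addr_ge0 ?exprn_ge0.
  by rewrite real_exprn_even_ge0// rpredB// ger0_real.
by rewrite big_split /= lerD ?fM ?gN.
Qed.

Lemma l2_dotE (f g : l2) s : has_sum (fun x => f x * Num.conj (g x)) s ->
  l2_dot f g = s.
Proof. exact: sumCE. Qed.

Lemma l2_dot_herm (f g : l2) : l2_dot f g = (-1) ^+ false * Num.conj (l2_dot g f).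
Proof.
rewrite expr0 mul1r; apply: l2_dotE.
have := has_sum_conj (l2_dotP g f).
by congr has_sum; apply/funext => x; rewrite rmorphM /= conjCK mulrC.
Qed.

Lemma l2_dot_linearl (g : l2) : linear_for *%R (l2_dot^~ g).
Proof.
move=> c f f'; apply: l2_dotE.
have := has_sum_linear c (l2_dotP f g) (l2_dotP f' g).
by congr has_sum; apply/funext => x; rewrite mulrA -mulrDl.
Qed.

Lemma l2_dot_linearr (f : l2) : linear_for (Num.conj \; *%R) (l2_dot f).
Proof.
move=> c g g'; rewrite l2_dot_herm l2_dot_linearl rmorphD rmorphM /=.
by rewrite mul1r [in RHS]l2_dot_herm [l2_dot f g']l2_dot_herm !mul1r.
Qed.

HB.instance Definition _ := bilinear_isBilinear.Build R[i] l2 l2 R[i]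
  *%R (Num.conj \; *%R) l2_dot (l2_dot_linearl, l2_dot_linearr).
HB.instance Definition _ := isHermitianSesquilinear.Build R[i] l2 false
  (@Num.conj R[i]) l2_dot l2_dot_herm.

Lemma l2_dot_bounded (f : l2) :
  0 <= l2_dot f f /\ bounded_sums (fun x => `|f x| ^+ 2) (l2_dot f f).
Proof.
have [M fM] := l2_bounded f.
have [|s [hs s0 sM ls]] := has_sum_nonneg _ fM; first by move=> x; rewrite exprn_ge0.
suff -> : l2_dot f f = s by [].
by apply: l2_dotE; move: hs; congr has_sum; apply/funext => x; rewrite normCK.
Qed.

Lemma l2_dot_le (f : l2) M : bounded_sums (fun x => `|f x| ^+ 2) M -> l2_dot f f <= M.
Proof.
move=> fM.
have [|s [hs s0 sM ls]] := has_sum_nonneg _ fM; first by move=> x; rewrite exprn_ge0.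
suff -> : l2_dot f f = s by [].
by apply: l2_dotE; move: hs; congr has_sum; apply/funext => x; rewrite normCK.
Qed.

Lemma l2_coord_le (f : l2) x : `|f x| ^+ 2 <= l2_dot f f.
Proof.
by have [_ /(_ [:: x] isT)] := l2_dot_bounded f; rewrite big_seq1.
Qed.

Lemma l2_dot_gt0 (f : l2) : f != 0 -> 0 < l2_dot f f.
Proof.
move=> f0; rewrite lt_def (l2_dot_bounded f).1 andbT.
apply: contra f0 => /eqP f0; apply/eqP/l2_ext => x; apply/eqP.
rewrite -normr_eq0 -sqrf_eq0 eq_le exprn_ge0// andbT -[leRHS]f0.
exact: l2_coord_le.
Qed.

HB.instance Definition _ := isDotProduct.Build R[i] l2 l2_dot l2_dot_gt0.

Lemma l2_normD (f g : l2) :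
  sqrtC (l2_dot (f + g) (f + g)) <= sqrtC (l2_dot f f) + sqrtC (l2_dot g g).
Proof.
have f0 (h : l2) : 0 <= l2_dot h h := (l2_dot_bounded h).1.
rewrite -(@ler_pXn2r _ 2) ?nnegrE ?addr_ge0 ?sqrtC_ge0//.
have -> : l2_dot (f + g) (f + g) =
    l2_dot f f + l2_dot g g + (l2_dot f g + Num.conj (l2_dot f g)).
  by rewrite hnormD expr0 mul1r.
rewrite sqrrD !sqrtCK [leRHS]addrAC lerD2l.
set z := l2_dot f g.
have : `|z| ^+ 2 <= l2_dot f f * l2_dot g g by exact: dot_CauchySchwarz.
rewrite -[X in _ <= X * _]sqrtCK -[X in _ <= _ * X]sqrtCK -exprMn.
rewrite ler_pXn2r ?nnegrE ?mulr_ge0 ?sqrtC_ge0// => zle.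
rewrite (@le_trans _ _ (`|z + Num.conj z|))//.
  by rewrite real_ler_norm// CrealE rmorphD /= conjCK addrC.
rewrite (le_trans (ler_normD _ _))// norm_conjC mulr2n lerD//.
Qed.

Lemma l2_dotZl (c : R[i]) (f g : l2) : l2_dot (c *: f) g = c * l2_dot f g.
Proof. exact: linearZl_LR. Qed.

Lemma l2_dotZr (c : R[i]) (f g : l2) :
  l2_dot f (c *: g) = Num.conj c * l2_dot f g.
Proof. by rewrite !(l2_dot_herm f) l2_dotZl rmorphM /= expr0 !mul1r. Qed.

Lemma l2_normZ (c : R[i]) (f : l2) :
  sqrtC (l2_dot (c *: f) (c *: f)) = `|c| * sqrtC (l2_dot f f).
Proof.
have e : l2_dot (c *: f) (c *: f) = `|c| ^+ 2 * l2_dot f f.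
  by rewrite l2_dotZl l2_dotZr mulrA normCK.
rewrite e sqrtCM ?nnegrE ?exprn_ge0//; last exact: (l2_dot_bounded f).1.
by rewrite sqrCK.
Qed.

Lemma l2_norm_eq0 (f : l2) : sqrtC (l2_dot f f) = 0 -> f = 0.
Proof.
move=> /eqP; rewrite sqrtC_eq0 => /eqP f0; apply/eqP; apply: contraT.
by move=> /l2_dot_gt0; rewrite f0 ltxx.
Qed.

HB.instance Definition _ :=
  Lmodule_isNormed.Build R[i] l2 l2_normD l2_normZ l2_norm_eq0.

Lemma l2_norm_dot (f : l2) : `|f| ^+ 2 = l2_dot f f.
Proof. exact: sqrtCK. Qed.

Lemma l2_coord_norm_le (f : l2) x : `|f x| <= `|f|.
Proof.
by rewrite -(@ler_pXn2r _ 2) ?nnegrE// l2_norm_dot l2_coord_le.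
Qed.

Lemma l2_norm_le (f : l2) M : 0 <= M ->
  bounded_sums (fun x => `|f x| ^+ 2) (M ^+ 2) -> `|f| <= M.
Proof.
by move=> M0 fM; rewrite -(@ler_pXn2r _ 2) ?nnegrE// l2_norm_dot l2_dot_le.
Qed.

Lemma l2_bounded_norm (f : l2) : bounded_sums (fun x => `|f x| ^+ 2) (`|f| ^+ 2).
Proof. by rewrite l2_norm_dot; have [] := l2_dot_bounded f. Qed.

End SquareSummable.

Lemma complex_complete (R : realType) (F : set_system R[i]^o) :
  ProperFilter F -> cauchy F -> cvg F.
Proof.
move=> FF FC.
have part_cvg (h : R[i] -> R) : (forall z w, `|h z - h w|%:C <= `|z - w|) ->
    exists r : R, forall d : R, 0 < d -> F [set z | `|r - h z| < d].
  move=> hle; have hc : cvg (h @ F).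
    apply: cauchy_cvg; apply: cauchy_exP => d d0.
    have d0' : 0 < d%:C by rewrite ltcR.
    have /cauchyP/(_ _ d0')[z Fz] := FC; exists (h z).
    apply: (@filterS _ F _ (ball z d%:C) (h @^-1` ball (h z) d)) Fz => w.
    by rewrite /= -!ball_normE /= -ltcR; apply: le_lt_trans.
  exists (lim (h @ F)) => d d0.
  by have /cvgrPdist_lt/(_ d d0) := hc.
have [|a Fa] := part_cvg (@complex.Re R).
  by move=> z w; rewrite -raddfB normc_ge_Re.
have [|b Fb] := part_cvg (@complex.Im R).
  move=> z w; rewrite -raddfB; have := normc_ge_Re ((z - w) * 'i%C).
  by rewrite ReiNIm normrN normrM complexiE normCi mulr1.
apply/cvg_ex; exists (a +i* b : R[i]^o); apply/cvgrPdist_le => e /complex_gt0P[r r0 ->].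
have r2 : 0 < r / 2 by rewrite divr_gt0.
apply: filterS (filterI (Fa _ r2) (Fb _ r2)) => z [/= za zb].
have -> : (a +i* b) - z = (a - complex.Re z)%:C + 'i%C * (b - complex.Im z)%:C.
  by case: z {za zb} => x y; apply/eqP; rewrite eq_complex /=; apply/andP; split; apply/eqP; ring.
rewrite (le_trans (ler_normD _ _))// normrM complexiE normCi mul1r.
by rewrite !normc_def /= !expr0n !addr0 !sqrtr_sqr -rmorphD lecR (splitr r) lerD// ltW.
Qed.

Lemma closed_approx (R : realType) (V : normedModType R[i]) (S : set V) x :
  closed S -> (forall e : R[i], 0 < e -> exists2 y, S y & `|x - y| <= e) -> S x.
Proof.
move=> Scl h; apply: Scl => U /nbhs_ballP[e /= e0 eU].
have e2 : 0 < e / 2 by rewrite divr_gt0.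
have [y Sy xy] := h _ e2; exists y; split => //; apply: eU.
rewrite -ball_normE /= (le_lt_trans xy)// ltr_pdivrMr// mulr_natr mulr2n.
by rewrite ltrDl.
Qed.

Lemma filter_forall_seq (T : eqType) (U : Type) (F : set_system U)
    (P : T -> set U) (l : seq T) : Filter F ->
  (forall x, F (P x)) -> F [set u | forall x, x \in l -> P x u].
Proof.
move=> FF FP; elim: l => [|x l ih]; first exact: filterS filterT.
apply: filterS (filterI (FP x) ih) => u [Px Pl] y.
by rewrite inE => /orP[/eqP ->|/Pl].
Qed.

Section L2Hilbert.
Variables (R : realType) (X : choiceType).
Local Notation l2 := (l2 R X).
Implicit Types (f h : l2) (l : seq X).

Lemma l2_subE f h x : (f - h) x = f x - h x.
Proof. by []. Qed.

(** Coordinates converge, and a bound on each finite partial sum passes to the coordinatewise limit;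
    this controls the whole norm uniformly. *)
Lemma l2_complete (F : set_system l2) : ProperFilter F -> cauchy F -> cvg F.
Proof.
move=> FF FC.
have FCe (e : R[i]) : 0 < e -> exists T0 : l2, F (ball T0 e).
  by move=> e0; move/cauchyP: FC; apply.
pose ev x (f : l2) : R[i]^o := f x.
have evC x : cvg (ev x @ F).
  apply: complex_complete; apply: cauchy_exP => e e0.
  have [T0 FT0] := FCe _ e0; exists (T0 x).
  apply: (@filterS _ F _ (ball T0 e) (ev x @^-1` ball (T0 x : R[i]^o) e)) FT0 => f.
  rewrite /= -!ball_normE /=; apply: le_lt_trans.
  by rewrite -l2_subE l2_coord_norm_le.
pose L x := lim (ev x @ F).
have LT0 (T0 : l2) e : 0 < e -> F (ball T0 e) ->
    bounded_sums (fun x => `|T0 x - L x| ^+ 2) (e ^+ 2).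
  move=> e0 FT0 l ul; apply/ler_addgt0Pr => d d0.
  (* For a <= e and r <= 1, (a + r)^2 <= a^2 + (2 e + 1) r. Over the list the excess is c r, and r =
     d / (c + d + 1) keeps it below d. *)
  pose c : R[i] := (size l)%:R * (2 * e + 1).
  have c0 : 0 <= c by rewrite mulr_ge0 ?addr_ge0// mulr_ge0// ltW.
  have c1 : 0 < c + d + 1 by rewrite addr_gt0// ltr_wpDl.
  pose r := d / (c + d + 1).
  have r0 : 0 < r by rewrite divr_gt0.
  have r1 : r <= 1 by rewrite ler_pdivrMr// mul1r addrAC lerDr addr_ge0.
  have cr : c * r <= d.
    rewrite mulrCA ler_piMr ?ltW// ltr_pdivrMr// mul1r -addrA ltrDl.
    by rewrite addr_gt0.
  have FL : F [set f : l2 | forall x, x \in l -> `|L x - ev x f| < r].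
    apply: filter_forall_seq => x.
    by have /cvgrPdist_lt/(_ r r0) := evC x.
  have [f [/= h1 h2]] := filter_ex (filterI FT0 FL).
  move: h1; rewrite -ball_normE /= => h1.
  apply: (@le_trans _ _ (\sum_(x <- l) (`|(T0 - f) x| ^+ 2 + (2 * e + 1) * r))).
    rewrite big_seq [leRHS]big_seq; apply: ler_sum => x xl.
    have a1 : `|T0 x - f x| <= e.
      by rewrite -l2_subE (le_trans (l2_coord_norm_le _ _))// ltW.
    have b1 : `|f x - L x| <= r by rewrite distrC ltW// h2.
    apply: (@le_trans _ _ ((`|T0 x - f x| + r) ^+ 2)).
      rewrite ler_pXn2r ?nnegrE ?addr_ge0 ?(ltW r0)//.
      by rewrite -(subrKA (f x)) (le_trans (ler_normD _ _))// lerD2l.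
    rewrite sqrrD -addrA l2_subE lerD2l mulrDl mul1r expr2 lerD//; last first.
      by rewrite ler_piMr// ltW.
    by rewrite -mulr_natl mulrA ler_wpM2r ?(ltW r0)// ler_wpM2l.
  rewrite big_split /= lerD//; last first.
    apply: le_trans cr; rewrite /c -mulrA le_eqVlt; apply/orP; left; apply/eqP.
    elim: (l) => [|x m ih]; first by rewrite big_nil mul0r.
    rewrite big_cons ih /=; set t := (2 * e + 1) * r.
    by rewrite -[(size m).+1]add1n natrD mulrDl mul1r.
  apply: (le_trans (l2_bounded_norm (T0 - f) ul)).
  by rewrite ler_pXn2r ?nnegrE// ltW.
have subP (T0 : l2) e : 0 < e -> F (ball T0 e) ->
    ((T0 : X -> R[i]^o) - L) \in @square_summable R X.
  by move=> e0 FT0; apply/asboolP; exists (e ^+ 2); exact: LT0.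
have LP : L \in @square_summable R X.
  have [T0 FT0] := FCe 1 ltr01.
  have -> : L = (T0 : X -> R[i]^o) - ((T0 : X -> R[i]^o) - L) by rewrite opprB addrC subrK.
  by apply: rpredB; [exact: l2P|exact: subP FT0].
apply/cvg_ex; exists (L2 LP); apply/cvgrPdist_le => e e0.
have e2 : 0 < e / 2 by rewrite divr_gt0.
have [T0 FT0] := FCe _ e2.
apply: (filterS _ (FT0)) => T T0T.
rewrite -(subrKA T0) (le_trans (ler_normD _ _))// (splitr e) lerD//.
  by rewrite distrC; apply: l2_norm_le; [exact: ltW|exact: LT0].
by apply/ltW; move: T0T; rewrite -ball_normE.
Qed.

HB.instance Definition _ := Uniform_isComplete.Build l2 l2_complete.
HB.instance Definition _ := isHilbert.Build R l2
  (fun f => l2_norm_dot f : `|f| ^+ 2 = (@l2_dot R X : {dot l2 for (@Num.conj R[i])}) f f).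

Lemma l2_dotpE f h : dotp f h = l2_dot f h.
Proof. by []. Qed.

(** Stated for all [g] dominated by [f] so as to serve twice: for cutting [f] down to a finite list,
    and for restricting it to paths with a given beginning. *)
Lemma l2_tail f (e : R[i]) : 0 < e -> exists l, forall g : l2,
  (forall x, `|g x| <= `|f x|) -> (forall x, x \in l -> g x = 0) -> `|g| <= e.
Proof.
move=> e0; have [l hl] := l2_dotP f f (exprn_gt0 2 e0).
exists l => g gf gl; apply: l2_norm_le; first exact: ltW.
move=> m um.
pose A := undup l; pose B := [seq x <- m | x \notin A].
have uAB : uniq (A ++ B).
  rewrite cat_uniq undup_uniq filter_uniq// andbT.
  by apply/hasPn => x; rewrite mem_filter => /andP[].
have hA : `|l2_dot f f - \sum_(x <- A) f x * Num.conj (f x)| <= e ^+ 2.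
  by apply: hl; [exact: undup_uniq|move=> x; rewrite mem_undup].
apply: (@le_trans _ _ (\sum_(x <- B) `|f x| ^+ 2)).
  rewrite (bigID (fun x => x \in A)) /= big1 ?add0r => [|x].
    rewrite big_filter; apply: ler_sum => x _.
    by rewrite ler_pXn2r ?nnegrE.
  by rewrite mem_undup => /gl ->; rewrite normr0 expr0n.
have := l2_bounded_norm f uAB; rewrite big_cat /= -lerBrDl => h.
rewrite (le_trans h)// (le_trans _ hA)// l2_norm_dot.
have -> : \sum_(x <- A) `|f x| ^+ 2 = \sum_(x <- A) f x * Num.conj (f x).
  by apply: eq_bigr => x _; rewrite normCK.
rewrite real_ler_norm// rpredB ?ger0_real ?(l2_dot_bounded f).1//.
by rewrite sumr_ge0// => x _; rewrite -normCK exprn_ge0.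
Qed.

Lemma delta_square_summable y : (fun x => (x == y)%:R : R[i]^o) \in @square_summable R X.
Proof.
apply/asboolP; exists 1 => l ul.
have [yl|yl] := boolP (y \in l).
  rewrite (bigD1_seq y)//= eqxx normr1 expr1n big1 ?addr0// => x /negbTE ->.
  by rewrite normr0 expr0n.
rewrite big1_seq ?ler01// => x /andP[_ xl].
by rewrite (negbTE (memPn yl x xl)) normr0 expr0n.
Qed.

Definition delta y : l2 := L2 (delta_square_summable y).

Lemma deltaE y x : delta y x = (x == y)%:R.
Proof. by []. Qed.

Lemma delta_norm y : `|delta y| = 1.
Proof.
apply/eqP; rewrite eq_le; apply/andP; split.
  apply: l2_norm_le => //; rewrite expr1n.
  move=> l ul; have [yl|yl] := boolP (y \in l).
    rewrite (bigD1_seq y)//= eqxx normr1 expr1n big1 ?addr0// => x /negbTE ->.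
    by rewrite normr0 expr0n.
  rewrite big1_seq ?ler01// => x /andP[_ xl].
  by rewrite deltaE (negbTE (memPn yl x xl)) normr0 expr0n.
by have := l2_coord_norm_le (delta y) y; rewrite deltaE eqxx normr1.
Qed.

Lemma l2_dense (S : set l2) : closed_subspace S -> (forall y, S (delta y)) ->
  S = setT.
Proof.
move=> [Scl S0 Slin] Sd; apply/seteqP; split => // f _.
apply: closed_approx Scl _ => e e0; have [l hl] := l2_tail f e0.
pose fl : l2 := \sum_(y <- undup l) f y *: delta y.
have flE x : fl x = if x \in l then f x else 0.
  have -> : fl x = \sum_(y <- undup l) f y * (x == y)%:R.
    rewrite /fl; elim: (undup l) => [|y m ih]; first by rewrite !big_nil.
    by rewrite !big_cons -ih.
  have [xl|xl] := boolP (x \in l).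
    rewrite (bigD1_seq x) ?mem_undup ?undup_uniq//= eqxx mulr1 big1 ?addr0// => y.
    by rewrite eq_sym => /negbTE ->; rewrite mulr0.
  rewrite big1_seq// => y; rewrite mem_undup => /andP[_ yl].
  by rewrite (negbTE (memPnC xl y yl)) mulr0.
exists fl.
  rewrite /fl; elim: (undup l) => [|y m ih]; first by rewrite big_nil.
  by rewrite big_cons; exact: Slin.
apply: hl => x; rewrite l2_subE flE; case: ifP => // _.
- by rewrite subrr normr0.
- by rewrite subr0.
- by rewrite subrr.
Qed.

(** * Partial isometries of l^2 induced by partial injections *)

Section PullOperator.
Variables (g g' : X -> option X).
Hypothesis gg' : partial_inverse g g'.

Lemma pull_bounded f : bounded_sums (fun x => `|pullback g f x| ^+ 2) (`|f| ^+ 2).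
Proof.
move=> l ul.
have -> : \sum_(x <- l) `|pullback g f x| ^+ 2 =
    \sum_(x <- l) pullback g (fun y => `|f y| ^+ 2) x.
  apply: eq_bigr => x _; rewrite /pullback; case: (g x) => //=.
  by rewrite normr0 expr0n.
rewrite sum_pullback; apply: l2_bounded_norm.
exact: pmap_partial_uniq gg' ul.
Qed.

Lemma pull_square_summable f : (pullback g f : X -> R[i]^o) \in @square_summable R X.
Proof. by apply/asboolP; exists (`|f| ^+ 2); exact: pull_bounded. Qed.

Definition pull f : l2 := L2 (pull_square_summable f).

Lemma pull_norm f : `|pull f| <= 1 * `|f|.
Proof. by rewrite mul1r; apply: l2_norm_le => //; exact: pull_bounded. Qed.

End PullOperator.

Lemma pull_adjoint g g' (gg' : partial_inverse g g') (g'g : partial_inverse g' g) :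
  adjoint_pair (pull gg') (pull g'g).
Proof.
move=> f h; rewrite !l2_dotpE; apply: l2_dotE.
have := has_sum_pullback gg' _ (l2_dotP f (pull g'g h)).
have w0 y : g' y = None -> f y * Num.conj (pull g'g h y) = 0.
  by rewrite /= /pullback => -> /=; rewrite rmorph0 mulr0.
move=> /(_ w0); congr has_sum; apply/funext => x; rewrite /pull /= /pullback.
case gx : (g x) => [y|] /=; last by rewrite mul0r.
by move/gg': gx => -> /=.
Qed.

Lemma pull_op_subproof g g' (gg' : partial_inverse g g') :
  pull gg' \in @bounded_adjointable R l2.
Proof.
apply/asboolP; split; first by exists 1 => // f; exact: pull_norm.
by exists (pull (partial_inverse_sym gg')); exact: pull_adjoint.
Qed.

Definition pull_op g g' (gg' : partial_inverse g g') : bounded_op l2 :=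
  BoundedOp (pull_op_subproof gg').

Lemma pull_opE g g' (gg' : partial_inverse g g') f x :
  pull_op gg' f x = oapp f 0 (g x).
Proof. by []. Qed.

Lemma star_pull_op g g' (gg' : partial_inverse g g') (g'g : partial_inverse g' g) :
  star (pull_op gg') = pull_op g'g.
Proof. by apply: star_op_uniq; exact: pull_adjoint. Qed.

End L2Hilbert.

(** * The representation on a tail-equivalence class *)

HB.instance Definition _ (R : realType) (H : hilbertType R) (T : bounded_op H) :=
  GRing.isLinear.Build R[i] H H *:%R (bounded_op_fun T) (bounded_op_linear T).

Section PathRepresentation.
Variables (R : realType) (E : digraph) (p0 : nat -> edge E).
Hypothesis hrow : row_finite E.
Hypothesis p0P : infinite_paths p0.
Implicit Types (e : edge E) (v : vertex E).

Definition class_path := {q : nat -> edge E | q \in path_class p0}.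
Implicit Types (q r : class_path).
Local Notation l2X := (l2 R class_path).

Lemma class_pathP q : path_class p0 (val q).
Proof. exact: set_mem (valP q). Qed.

Lemma class_path_infinite q : infinite_paths (val q).
Proof. by have [] := class_pathP q. Qed.

Lemma tail_equiv_pshift (q : nat -> edge E) k : tail_equiv q (pshift k q).
Proof. by exists k, 0%N => i; rewrite /pshift add0n. Qed.

Lemma class_shift_subproof q : pshift 1 (val q) \in path_class p0.
Proof.
have [qp qe] := class_pathP q; apply/mem_set; split.
  exact: pshift_infinite.
exact: tail_equiv_trans qe (tail_equiv_pshift _ _).
Qed.

Definition class_shift q : class_path :=
  exist (fun r : nat -> edge E => r \in path_class p0) _ (class_shift_subproof q).

Lemma concat1_pshift (q : nat -> edge E) : concat [:: q 0%N] (pshift 1 q) = q.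
Proof. by apply/funext => -[|i]; rewrite /concat /pshift//= subn1 add1n. Qed.

Lemma pshift1_concat e (q : nat -> edge E) : pshift 1 (concat [:: e] q) = q.
Proof. by apply/funext => i; rewrite /pshift (concat_pshift [:: e]). Qed.

Lemma concat1_class e q : path_origin (val q) = terminus e ->
  concat [:: e] (val q) \in path_class p0.
Proof.
move=> qe; have [qp q0] := class_pathP q; apply/mem_set; split.
  apply: concat_infinite qp qe => /=; exact/andP.
apply: tail_equiv_trans q0 _; exists 0%N, 1%N => i.
by rewrite (concat_pshift [:: e]).
Qed.

(* The pullbacks along [uncons e] and [cons e] are the operators
   d_q |-> d_(e q) and its adjoint. *)
Definition uncons e q : option class_path :=
  if val q 0%N == e then Some (class_shift q) else None.

Definition cons_path e q : option class_path :=
  if path_origin (val q) == terminus e then insub (concat [:: e] (val q)) else None.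

Definition at_vertex v q : option class_path :=
  if path_origin (val q) == v then Some q else None.

Lemma uncons_inverse e : partial_inverse (uncons e) (cons_path e).
Proof.
move=> x y; rewrite /uncons /cons_path; split.
  case: eqP => // xe [<-] /=.
  have -> : path_origin (pshift 1 (val x)) == terminus e.
    by rewrite /path_origin /pshift -xe (class_path_infinite x 0).
  by rewrite -xe concat1_pshift valK.
case: eqP => // ye; case: insubP => // z _ zE [<-].
rewrite zE /concat /= eqxx; congr Some; apply: val_inj => /=.
by rewrite zE pshift1_concat.
Qed.

Lemma at_vertex_inverse v : partial_inverse (at_vertex v) (at_vertex v).
Proof.
move=> x y; rewrite /at_vertex; split.
  by case: (eqVneq (path_origin (val x)) v) => // xv [<-]; rewrite xv eqxx.
by case: (eqVneq (path_origin (val y)) v) => // yv [<-]; rewrite yv eqxx.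
Qed.

Lemma cons_inverse e : partial_inverse (cons_path e) (uncons e).
Proof. exact: partial_inverse_sym (uncons_inverse e). Qed.

Definition path_s e : bounded_op l2X := pull_op R (uncons_inverse e).
Definition path_s' e : bounded_op l2X := pull_op R (cons_inverse e).
Definition path_p v : bounded_op l2X := pull_op R (at_vertex_inverse v).

Lemma path_pE v (f : l2X) q : path_p v f q = if path_origin (val q) == v then f q else 0.
Proof. by rewrite pull_opE /at_vertex; case: ifP. Qed.

Lemma path_sE e (f : l2X) q : path_s e f q = if val q 0%N == e then f (class_shift q) else 0.
Proof. by rewrite pull_opE /uncons; case: ifP. Qed.

Lemma path_s's e (f : l2X) : path_s' e (path_s e f) = path_p (terminus e) f.
Proof.
apply: l2_ext => q; rewrite path_pE pull_opE /cons_path.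
case: eqP => // qe; case: insubP => [z _ zE|/negP[]]; last exact: concat1_class.
rewrite [LHS](path_sE e f z) zE /concat /= eqxx; congr (f _); apply: val_inj => /=.
by rewrite zE pshift1_concat.
Qed.

Lemma path_ss' e (f : l2X) q :
  path_s e (path_s' e f) q = if val q 0%N == e then f q else 0.
Proof.
rewrite path_sE; case: eqP => // qe.
by rewrite pull_opE (iffLR (uncons_inverse e q _))// /uncons qe eqxx.
Qed.

Lemma star_path_s e : star (path_s e) = path_s' e.
Proof. exact: star_pull_op. Qed.

Lemma path_cuntz_krieger : cuntz_krieger path_p path_s.
Proof.
split.
- move=> v; split; last exact: star_pull_op.
  apply: bounded_opE => f; apply: l2_ext => q.
  by rewrite [LHS]path_pE !path_pE; case: ifP => [->|_].
- move=> v w vw; apply: bounded_opE => f; apply: l2_ext => q.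
  rewrite [LHS]path_pE path_pE; case: eqP => // ->.
  by case: eqP.
- move=> e; apply: bounded_opE => f; apply: l2_ext => q.
  by rewrite star_path_s [LHS]path_ss' path_sE; case: ifP => [->|_].
- move=> e; apply: bounded_opE => f; rewrite star_path_s.
  exact: path_s's.
- move=> v; apply: bounded_opE => f; apply: l2_ext => q.
  have fv := hrow v; rewrite fsbig_finite// [RHS]path_pE.
  have -> : (\sum_(e <- fset_set (emitted v)) (path_s e ** star (path_s e))) f q =
      \sum_(e <- fset_set (emitted v)) (if val q 0%N == e then f q else 0).
    elim: (enum_fset _) => [|e l ih]; first by rewrite !big_nil.
    by rewrite !big_cons -ih -path_ss' -star_path_s.
  case: eqP => qv.
    rewrite (bigD1_seq (val q 0%N)) ?fset_uniq ?in_emitted//=; last exact/eqP.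
    rewrite eqxx big1 ?addr0// => e; rewrite eq_sym => /negbTE ->//.
  rewrite big1_seq// => e /andP[_]; rewrite in_fset_set// inE => ev.
  by case: eqP => // qe; case: qv; rewrite /path_origin qe.
Qed.

Lemma pull_delta (X : choiceType) (g g' : X -> option X)
    (gg' : partial_inverse g g') y :
  pull_op R gg' (delta R y) = oapp (@delta R X) 0 (g' y).
Proof.
apply: l2_ext => x; rewrite pull_opE; case gx : (g x) => [z|].
  rewrite [LHS]deltaE; case g'y : (g' y) => [x'|].
    rewrite [RHS]deltaE; congr (_%:R); congr nat_of_bool; apply/eqP/eqP => [zy|xx'].
      by move/gg': gx; rewrite zy g'y => -[].
    by move/gg': g'y; rewrite -xx' gx => -[].
  have [zy|//] := eqVneq z y; move/gg': gx; rewrite zy g'y //.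
case g'y : (g' y) => [x'|//]; rewrite [RHS]deltaE.
have [xx'|//] := eqVneq x x'; move/gg': g'y; rewrite -xx' gx //.
Qed.

Lemma val_iter_shift k q : val (iter k class_shift q) = pshift k (val q).
Proof.
elim: k => [|k ih] /=; first by apply/funext => i; rewrite /pshift add0n.
by rewrite ih pshift_pshift addn1.
Qed.

Section Invariant.
Variable S : set l2X.
Hypothesis Ssub : closed_subspace S.
Hypothesis S_s : forall e f, S f -> S (path_s e f).
Hypothesis S_s' : forall e f, S f -> S (path_s' e f).

(** The map f |-> h is s_m s_m^* for the word m of the first [k] letters of [q], built one letter at
    a time. *)
Lemma invariant_restrict k (q : nat -> edge E) f : S f -> exists2 h : l2X, S h &
  forall r, h r = if all (fun i => val r i == q i) (iota 0 k) then f r else 0.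
Proof.
elim: k q f => [|k ih] q f Sf; first by exists f.
have [h Sh hE] := ih (pshift 1 q) _ (S_s' (q 0%N) Sf).
exists (path_s (q 0%N) h); first exact: S_s.
move=> r; rewrite path_sE -[iota 0 k.+1]/(0%N :: iota (1 + 0) k).
rewrite iotaDl /= all_map; case: eqP => //= rq; rewrite hE.
case: ifP => // _; rewrite pull_opE.
have /uncons_inverse -> // : uncons (q 0%N) r = Some (class_shift r).
by rewrite /uncons; case: eqP.
Qed.

Lemma l2_subZ_delta (h : l2X) c q r :
  (h - c *: delta R q) r = h r - c * (r == q)%:R.
Proof. by []. Qed.

(** The restrictions to longer and longer beginnings of [q] converge in norm to [f q *: delta R q].
    A finite list carries [f] up to [e], and some [k] separates [q] from every other path of that
    list. *)
Lemma invariant_delta f q : S f -> f q <> 0 -> S (delta R q).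
Proof.
have [Scl S0 Slin] := Ssub; move=> Sf fq.
suff h : S (f q *: delta R q).
  rewrite -[delta R q]scale1r -(mulVf (x := f q)); last exact/eqP.
  by rewrite -scalerA -[_ *: _]addr0; exact: Slin.
apply: closed_approx Scl _ => e e0; have [l hl] := l2_tail f e0.
have [k kP] : exists k, forall r, r \in l -> r <> q ->
    exists2 i, (i < k)%N & val r i <> val q i.
  elim: l {hl} => [|r l [k kP]]; first by exists 0%N.
  have [->|rq] := pselect (r = q).
    by exists k => r'; rewrite inE => /orP[/eqP -> //|]; exact: kP.
  have [i ri] : exists i, val r i <> val q i.
    apply: contrapT => h; apply: rq; apply/val_inj/funext => i.
    by apply: contrapT => ?; apply: h; exists i.
  exists (maxn k i.+1) => r'; rewrite inE => /orP[/eqP -> _|r'l /(kP _ r'l)[j jk r'j]].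
    by exists i => //; rewrite leq_max ltnSn orbT.
  by exists j => //; rewrite leq_max jk.
have [h Sh hE] := invariant_restrict k (val q) Sf.
exists h => //; rewrite distrC; apply: hl => [r|r rl].
  rewrite l2_subZ_delta hE.
  have [->|rq] := eqVneq r q.
    have -> : all (fun i => val q i == val q i) (iota 0 k) by apply/allP.
    by rewrite mulr1 subrr normr0.
  by rewrite mulr0 subr0; case: ifP; rewrite ?normr0.
rewrite l2_subZ_delta hE.
have [->|/eqP rq] := eqVneq r q.
  have -> : all (fun i => val q i == val q i) (iota 0 k) by apply/allP.
  by rewrite mulr1 subrr.
have [i ik ri] := kP r rl rq; rewrite mulr0 subr0; case: ifP => // /allP/(_ i).
by rewrite mem_iota ik => /(_ isT)/eqP.
Qed.

Lemma invariant_delta_shift q : S (delta R (class_shift q)) <-> S (delta R q).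
Proof.
split=> [/(S_s (val q 0%N))|/(S_s' (val q 0%N))]; rewrite pull_delta.
  by rewrite (iffLR (uncons_inverse (val q 0%N) q _))// /uncons eqxx.
by rewrite /uncons eqxx.
Qed.

Lemma invariant_delta_iter k q :
  S (delta R (iter k class_shift q)) <-> S (delta R q).
Proof.
elim: k => [//|k ih]; split=> [/invariant_delta_shift/ih //|/ih h].
exact/invariant_delta_shift.
Qed.

(** Tail equivalent paths become equal after suitable shifts, and membership of basis vectors in [S]
    passes through shifts in both directions. *)
Lemma invariant_total f : S f -> f <> 0 -> S = setT.
Proof.
move=> Sf f0; have [q fq] : exists q, f q <> 0.
  apply: contrapT => h; apply: f0; apply: l2_ext => q.
  by apply: contrapT => ?; apply: h; exists q.
have Sq := invariant_delta Sf fq.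
apply: (l2_dense Ssub) => r.
have [_ qe] := class_pathP q; have [_ re] := class_pathP r.
have [j [k jk]] := tail_equiv_trans (tail_equiv_sym qe) re.
apply/(invariant_delta_iter k).
have -> : iter k class_shift r = iter j class_shift q.
  by apply: val_inj; rewrite !val_iter_shift; apply/funext => i; rewrite /pshift jk.
exact/invariant_delta_iter.
Qed.

End Invariant.

Lemma delta_dist q r : q <> r -> 1 < `|delta R q - delta R r|.
Proof.
move=> /eqP qr; have un : uniq [:: q; r] by rewrite /= inE qr.
have := l2_bounded_norm (delta R q - delta R r) un.
rewrite big_cons big_seq1 !l2_subE !deltaE !eqxx (negbTE qr) eq_sym (negbTE qr).
rewrite subr0 sub0r normrN normr1 expr1n => h.
rewrite -(@ltr_pXn2r _ 2) ?nnegrE// expr1n (lt_le_trans _ h)//.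
by rewrite ltrDl.
Qed.

Variables (A : cstarAlgType R) (p : vertex E -> A) (s : edge E -> A).
Hypothesis hA : is_graph_algebra p s.

Lemma liminal_finite_class v : liminal A ->
  finite_set (path_class p0 `&` [set q | path_origin q = v]).
Proof.
move=> lA.
have [f [fM fS] [fp fs]] := ga_universal hA path_cuntz_krieger.
pose pi (a : A) : {linear l2X -> l2X} := bounded_op_fun (f a).
have fs' e : f (star (s e)) = path_s' e by rewrite fS fs star_path_s.
have rep : is_representation pi.
  split.
  - move=> a; apply: (lipschitz_continuous (C := `|f a|)) => // x y.
    by rewrite -linearB bounded_op_norm.
  - by move=> c a b x; rewrite /pi /= linearP.
  - by move=> a b x; rewrite /pi /= fM.
  - by move=> a x y; rewrite /pi /= fS; exact: star_opP.
have piE a x : pi a x = f a x by [].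
pose q0 : class_path := exist (fun r : nat -> edge E => r \in path_class p0) p0
  (mem_set (conj p0P (tail_equiv_refl p0))).
have delta0 q : delta R q <> 0.
  by move=> h; have := delta_norm R q; rewrite h normr0 => /esym/eqP; rewrite oner_eq0.
have irr : irreducible pi.
  split.
    exists (p (path_origin p0)), (delta R q0).
    rewrite piE fp => /(congr1 (fun g : l2X => g q0)); rewrite path_pE eqxx.
    by rewrite deltaE eqxx => /eqP; rewrite oner_eq0.
  move=> S Ssub Sinv.
  have [[g [Sg g0]]|hn] := pselect (exists g, S g /\ g <> 0); [right|left].
    apply: (invariant_total Ssub _ _ Sg g0) => e h Sh.
      by have := Sinv (s e) h Sh; rewrite piE fs.
    by have := Sinv (star (s e)) h Sh; rewrite piE fs'.
  apply/seteqP; split => [g Sg|g ->]; last by have [] := Ssub.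
  by apply: contrapT => g0; apply: hn; exists g.
have /precompact_totally_bounded K := lA _ pi rep irr (p v).
(* Distinct basis vectors are more than 1 apart, so a point of a net with radius 1/2 serves at most
   one of them, and the net bounds the number of paths. *)
have h2 : 0 < 2^-1 :> R[i] by rewrite invr_gt0.
have [l hl] := K _ h2.
set Y := _ `&` _.
have /choice[F FP] : forall q : nat -> edge E, exists y : l2X, Y q ->
    y \in l /\ forall qX : class_path, val qX = q -> `|delta R qX - y| <= 2^-1.
  move=> q; have [Yq|nYq] := pselect (Y q); last by exists 0.
  have [qc qv] := Yq.
  pose qX : class_path := exist (fun r : nat -> edge E => r \in path_class p0) q (mem_set qc).
  have [|y yl yd] := hl (delta R qX).
    (* p_v fixes this basis vector, which therefore lies in the image of the unit ball. *)
    exists (delta R qX); first by rewrite /= delta_norm.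
    rewrite piE fp; apply: l2_ext => r; rewrite path_pE deltaE.
    case: eqP => // rv; have [rq|//] := eqVneq r qX.
    by case: rv; rewrite rq.
  exists y => _; split; [exact: yl|move=> rX rq].
  have -> : rX = qX by apply: val_inj.
  exact: yd.
have FY : finite_set (F @` Y).
  apply: (@sub_finite_set _ _ [set` l]); last exact: finite_seq.
  by move=> _ [q Yq <-]; have [] := FP q Yq.
have Finj : {in Y &, injective F}.
  move=> q r /set_mem Yq /set_mem Yr Fqr; apply: contrapT => qr.
  have [qc qv] := Yq; have [rc rv] := Yr.
  pose qX : class_path := exist (fun r : nat -> edge E => r \in path_class p0) q (mem_set qc).
  pose rX : class_path := exist (fun r : nat -> edge E => r \in path_class p0) r (mem_set rc).
  have [_ /(_ qX erefl) dq] := FP q Yq; have [_ /(_ rX erefl) dr] := FP r Yr.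
  have : qX <> rX by move=> /(congr1 val).
  move=> /delta_dist h.
  have := lt_le_trans h (ler_distD (F q) _ _).
  rewrite {2}Fqr [X in _ + X]distrC => /lt_le_trans /(_ (lerD dq dr)).
  by rewrite -[2^-1]mul1r -splitr ltxx.
by rewrite -(eq_finite_set (inj_card_eq Finj)).
Qed.

End PathRepresentation.

Theorem theorem3p10 (R : realType) (E : digraph)
    (hrow : row_finite E) (hsinks : no_sinks E)
    (A : cstarAlgType R) (p : vertex E -> A) (s : edge E -> A)
    (hA : is_graph_algebra p s) :
  liminal A <-> condition_M E.
Proof.
split=> [lA v p0 p0P|M]; last exact (condition_M_liminal hrow hA M).
exact (liminal_finite_class hrow p0P hA v lA).
Qed.
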